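(* Let $W$ be a Gaussian white noise on $\mathbb R\times[0,1]^{\mathbb N}$ with intensity $\mathrm{Leb}_1\otimes P$ ($P$ the law of an i.i.d. uniform$[0,1]$ sequence), $W_l(dx,dy_1,\ldots,dy_l):=W(dx,dy_1,\ldots,dy_l,[0,1]^{\mathbb N})$, $\psi_0(x):=e^{-x}$, $\psi_l(x):=\frac{x^l}{l!}e^{-x}$. Define, for $u\in\mathbb R$, $$Z_1(u):=-\int_{\mathbb R\times[0,1]}\Big(\mathbf 1_{\{y\le \exp(-e^{-(x-u)})\}}-\exp(-e^{-(x-u)})\Big)W_1(dx,dy),$$ $$X_k(u):=\int_{\mathbb R\times[0,1]^{k+1}}\Big(\mathbf 1_{\{y_1\cdots y_{k+1}<\psi_0(e^{-(x-u)})<y_1\cdots y_k\}}-\psi_k(e^{-(x-u)})\Big)W_{k+1}(dx,dy_1,\ldots,dy_{k+1}),\quad k\in\mathbb N,$$ and $Z_l(u):=Z_1(u)-\sum_{k=1}^{l-1}X_k(u)$ for $l\in\mathbb N$. Then each $Z_l=(Z_l(u))_{u\in\mathbb R}$ is a centered stationary Gaussian process with $$\mathrm{Cov}(Z_l(u),Z_l(v))=\log(1+e^{-|u-v|})-\sum_{k=1}^{l-1}\frac{(2k-1)!\,e^{-|u-v|k}}{(k!)^2(1+e^{-|u-v|})^{2k}},\quad u,v\in\mathbb R,$$ and, for $l\in\mathbb N$, $n\in\mathbb N_0$, $u,v\in\mathbb R$, $$\mathbb E Z_l(u)Z_{l+n}(v)=\log(1+e^{-|u-v|})-\sum_{k=1}^{l-1}\frac{(2k-1)!\,e^{-|u-v|k}}{(k!)^2(1+e^{-|u-v|})^{2k}}+\sum_{r=0}^{n-1}\sum_{i=0}^{l-1}\Big(\frac{1}{l+r}\binom{l+r}{i}\big((1-e^{u-v})_+\big)^{l+r-i}e^{(u-v)i}-\frac{1}{l+r+i}\binom{l+r+i}{i}\frac{e^{(u-v)i}}{(1+e^{u-v})^{l+r+i}}\Big).$$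 Moreover, for each $l$, the process $Z_l$ has a version whose sample paths are Hölder continuous with exponent $\alpha$ for each $\alpha\in(0,1/2)$.
   Context: A Gaussian white noise $W$ on a measure space with intensity $\mu$ assigns to each set $A$ of finite $\mu$-measure a centered normal random variable $W(A)$ with $\mathbb E W(A)W(B)=\mu(A\cap B)$; integrals of deterministic square-integrable functions against $W$ are Wiener integrals. $\mathrm{Leb}_1$ is Lebesgue measure on $\mathbb R$. $x_+=\max(x,0)$. *)

(* Defs.v *)
From HB Require Import structures.
From mathcomp Require Import all_boot all_order all_algebra.
From mathcomp Require Import all_classical all_reals all_analysis.
Set Implicit Arguments. Unset Strict Implicit. Unset Printing Implicit Defensive.
Import Order.TTheory GRing.Theory Num.Theory.
Local Open Scope classical_set_scope.
Local Open Scope ring_scope.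

(* The sequence space R^N (carrying [0,1]^N) with its product sigma-algebra, *)
(* generated by the coordinate maps.                                         *)
Definition seq_space (R : realType) : Type := nat -> R.
HB.instance Definition _ (R : realType) := gen_eqMixin (seq_space R).
HB.instance Definition _ (R : realType) := gen_choiceMixin (seq_space R).
HB.instance Definition _ (R : realType) :=
  isPointed.Build (seq_space R) (fun _ => 0).

Definition coord_sets (R : realType) : set (set (seq_space R)) :=
  [set A | exists (i : nat) (B : set R),
     measurable B /\ A = (fun f : seq_space R => f i) @^-1` B].

Definition seqR (R : realType) := g_sigma_algebraType (@coord_sets R).

Definition iid_uniform (R : realType) (P : probability (seqR R) R) : Prop :=
  forall (n : nat) (B : nat -> set R), (forall i, measurable (B i)) ->
    P [set f : seqR R | forall i, (i < n)%N -> B i (f i)] =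
    (\prod_(i < n) lebesgue_measure (B i `&` `[0%R, 1%R]))%E.

Definition gaussian_rv (R : realType) (d : measure_display) (Om : measurableType d)
  (Prob : probability Om R) (X : Om -> R) (m s2 : R) : Prop :=
  measurable_fun setT X /\
  forall B : set R, measurable B ->
    Prob (X @^-1` B) =
    (if s2 == 0 then \d_m B else normal_prob m (Num.sqrt s2) B).

Definition noise_comb (R : realType) (S Om : Type) (W : set S -> Om -> R)
  (s : seq (R * set S)) (w : Om) : R :=
  \sum_(q <- s) q.1 * W q.2 w.

Definition step_fun (R : realType) (S : Type) (s : seq (R * set S)) (p : S) : R :=
  \sum_(q <- s) q.1 * indic q.2 p.

Definition finite_sets (R : realType) (d' : measure_display) (S : measurableType d')
  (mu : {measure set S -> \bar R}) (s : seq (R * set S)) : Prop :=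
  forall q, q \in s -> measurable q.2 /\ (mu q.2 < +oo)%E.

(* Gaussian white noise on S with intensity mu: for sets A of finite
   mu-measure, W(A) is a centered jointly Gaussian family with
   E W(A) W(B) = mu (A `&` B); equivalently every finite linear combination
   sum c_i W(A_i) is centered Gaussian with variance sum c_i c_j mu(A_i & A_j). *)
Definition gaussian_white_noise (R : realType) (d : measure_display)
  (Om : measurableType d) (Prob : probability Om R)
  (d' : measure_display) (S : measurableType d')
  (mu : {measure set S -> \bar R}) (W : set S -> Om -> R) : Prop :=
  forall s : seq (R * set S), finite_sets mu s ->
    gaussian_rv Prob (noise_comb W s) 0
      (\sum_(q <- s) \sum_(q' <- s) q.1 * q'.1 * fine (mu (q.2 `&` q'.2))).

Definition wiener_integral (R : realType) (d : measure_display)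
  (Om : measurableType d) (Prob : probability Om R)
  (d' : measure_display) (S : measurableType d')
  (mu : {measure set S -> \bar R}) (W : set S -> Om -> R)
  (f : S -> R) (I : Om -> R) : Prop :=
  [/\ measurable_fun setT f,
      (\int[mu]_p ((f p) ^+ 2)%:E < +oo)%E,
      measurable_fun setT I &
      forall g : nat -> seq (R * set S),
        (forall n, finite_sets mu (g n)) ->
        (fun n => (\int[mu]_p ((step_fun (g n) p - f p) ^+ 2)%:E)%E) @ \oo --> 0%E ->
        (fun n => (\int[Prob]_w ((noise_comb W (g n) w - I w) ^+ 2)%:E)%E)
          @ \oo --> 0%E].

Definition psi (R : realType) (l : nat) (x : R) : R :=
  x ^+ l / (l`!)%:R * expR (- x).

(* 1_{y <= exp(-e^{-(x-u)})} - exp(-e^{-(x-u)}),  y = y_1 = p.2 0 *)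
Definition Z1_integrand (R : realType) (u : R) (p : R * seqR R) : R :=
  let t := expR (- expR (- (p.1 - u))) in
  (if p.2 0%N <= t then 1 else 0) - t.

(* 1_{y_1...y_{k+1} < psi_0(e^{-(x-u)}) < y_1...y_k} - psi_k(e^{-(x-u)}),
   with y_j = p.2 (j-1) *)
Definition X_integrand (R : realType) (k : nat) (u : R) (p : R * seqR R) : R :=
  let t := expR (- (p.1 - u)) in
  (if (\prod_(i < k.+1) p.2 i < psi 0 t) && (psi 0 t < \prod_(i < k) p.2 i)
   then 1 else 0) - psi k t.

(* Z_l(u) = Z_1(u) - sum_{k=1}^{l-1} X_k(u),  where Z_1(u) = - I1(u) and
   I1(u) is the Wiener integral of Z1_integrand u. *)
Definition Zproc (R : realType) (Om : Type) (I1 : R -> Om -> R)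
  (X : nat -> R -> Om -> R) (l : nat) (u : R) (w : Om) : R :=
  - I1 u w - \sum_(1 <= k < l) X k u w.

Definition cov_l (R : realType) (l : nat) (u v : R) : R :=
  ln (1 + expR (- `|u - v|))
  - \sum_(1 <= k < l)
      ((2 * k - 1)`!%:R * expR (- `|u - v| * k%:R))
      / ((k`!%:R) ^+ 2 * (1 + expR (- `|u - v|)) ^+ (2 * k)).

Definition cross_cov (R : realType) (l n : nat) (u v : R) : R :=
  cov_l l u v
  + \sum_(0 <= r < n) \sum_(0 <= i < l)
      ( (l + r)%:R^-1 * 'C(l + r, i)%:R
          * (Num.max (1 - expR (u - v)) 0) ^+ (l + r - i) * expR ((u - v) * i%:R)
        - (l + r + i)%:R^-1 * 'C(l + r + i, i)%:R
          * expR ((u - v) * i%:R) / (1 + expR (u - v)) ^+ (l + r + i)).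

Definition gaussian_process (R : realType) (d : measure_display)
  (Om : measurableType d) (Prob : probability Om R) (Z : R -> Om -> R) : Prop :=
  forall s : seq (R * R), exists m s2 : R,
    0 <= s2 /\ gaussian_rv Prob (fun w => \sum_(q <- s) q.1 * Z q.2 w) m s2.

Definition centered (R : realType) (d : measure_display)
  (Om : measurableType d) (Prob : probability Om R) (Z : R -> Om -> R) : Prop :=
  forall u, (\int[Prob]_w (Z u w)%:E = 0)%E.

(* for a centered Gaussian process, (strict) stationarity is shift-invariance
   of the covariance *)
Definition stationary_cov (R : realType) (d : measure_display)
  (Om : measurableType d) (Prob : probability Om R) (Z : R -> Om -> R) : Prop :=
  forall h u v, (\int[Prob]_w (Z (u + h) w * Z (v + h) w)%:E =
                \int[Prob]_w (Z u w * Z v w)%:E)%E.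

Definition locally_hoelder (R : realType) (f : R -> R) (a : R) : Prop :=
  forall T : R, 0 < T -> exists C : R, forall s t : R,
    `|s| <= T -> `|t| <= T -> `|f s - f t| <= C * `|s - t| `^ a.

(* Main.v *)
(** Write [S k = y_1 ... y_k]. The indicators defining [X_k] telescope, so that almost
    everywhere the kernel of [Z_l(u)] is [P (S l < e^{-t}) - 1_{S l < e^{-t}}] with
    [t = e^{-(x-u)}]. Since the [- ln y_i] are independent exponential variables, [- ln (S k)] is
    the [k]-th point of a Poisson process; counting the points before [s] gives, for [l <= m],
    [P (S l < e^{-s}, S m < e^{-t}) = \sum_(i < l) psi i s * poisson_cdf (m - i) (t - s)_+].
    By the Wiener isometry and Fubini, the covariance of [Z_l(u)] and [Z_m(v)] is the
    [x]-integral of the covariance of two such indicators. As [psi i s * psi k (a s)] is a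
    multiple of [psi (i + k) ((1 + a) s)], the substitution [s = e^{-(x-u)}] leaves Gamma
    integrals for [i + k > 0] and, for [i = k = 0], Frullani integrals, which produce the
    logarithm. The remaining double sums of binomial coefficients are evaluated along columns by
    the binomial theorem and over squares by the problem of points.

    The covariance formula gives [E (Z_l(u) - Z_l(v))^2 <= 2 |u - v|]. The increments being
    Gaussian, the increments over dyadic intervals of length [2^-n] are eventually
    [O((n+1) 2^{-n/2})] by Borel-Cantelli, and dyadic chaining yields the Hoelder version. *)
Require Import Defs.
From HB Require Import structures.
From mathcomp Require Import all_boot all_order all_algebra.
From mathcomp Require Import finmap.
From mathcomp Require Import all_classical all_reals all_analysis.
From mathcomp Require Import measurable_realfun ring lra zify.
Set Implicit Arguments. Unset Strict Implicit. Unset Printing Implicit Defensive.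
Import Order.TTheory GRing.Theory Num.Theory.
Import numFieldNormedType.Exports.
Local Open Scope classical_set_scope.
Local Open Scope ring_scope.

(** * Square-integrable functions *)

Section square_integrable.
Context (d : measure_display) (T : measurableType d) (R : realType).
Variable mu : {measure set T -> \bar R}.
Implicit Types (f g h : T -> R) (F G : nat -> T -> R) (c : R).

Lemma Lfun2P f : f \in Lfun mu 2%:E <->
  measurable_fun setT f /\ (\int[mu]_x ((f x) ^+ 2)%:E < +oo)%E.
Proof.
split=> [f2|[mf f2]].
  split; first by move: f2; rewrite inE => /andP[]; rewrite inE.
  have /integrableP[_] := Lfun2_integrable_sqr f2.
  apply: le_lt_trans; rewrite le_eqVlt; apply/predU1P; left.
  by apply: eq_integral => x _; rewrite /= ger0_norm ?sqr_ge0.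
rewrite inE; apply/andP; split; rewrite inE//= /finite_norm unlock poweR_lty//.
rewrite (eq_integral (fun x => ((f x) ^+ 2)%:E))// => x _.
by rewrite /= (powR_mulrn 2)// real_normK ?num_real.
Qed.

Lemma Lfun2_le f g : measurable_fun setT f -> (forall x, `|f x| <= `|g x|) ->
  g \in Lfun mu 2%:E -> f \in Lfun mu 2%:E.
Proof.
move=> mf fg /Lfun2P[mg g2]; apply/Lfun2P; split=> //.
apply: le_lt_trans g2; apply: ge0_le_integral => //.
- by move=> x _; rewrite lee_fin sqr_ge0.
- by apply/measurable_EFinP; exact: measurable_funX.
- by apply/measurable_EFinP; exact: measurable_funX.
- move=> x _; rewrite lee_fin -(@real_normK _ (f x)) ?num_real//.
  by rewrite -(@real_normK _ (g x)) ?num_real// lerXn2r ?nnegrE.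
Qed.

Lemma Lfun2_linear f g c : f \in Lfun mu 2%:E -> g \in Lfun mu 2%:E ->
  (fun x => f x + c * g x) \in Lfun mu 2%:E.
Proof.
move=> f2 g2.
have cg2 : (fun x => c * g x) \in Lfun mu 2%:E.
  rewrite (_ : (fun x => _) = c \o* g); first by apply: Lfun_scale => //; rewrite ler1n.
  by apply/funext => x /=; rewrite mulrC.
by have [_ closedD] := Lfun_addr_closed mu (lee1n 2); exact: closedD.
Qed.

Lemma Lfun2B f g : f \in Lfun mu 2%:E -> g \in Lfun mu 2%:E ->
  (fun x => f x - g x) \in Lfun mu 2%:E.
Proof.
move=> f2 g2; have := Lfun2_linear (-1) f2 g2.
by under eq_fun do rewrite mulN1r.
Qed.

Definition L2dot f g : R := \int[mu]_x (f x * g x).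

Lemma integrable_mul_Lfun2 f g : f \in Lfun mu 2%:E -> g \in Lfun mu 2%:E ->
  mu.-integrable setT (fun x => (f x * g x)%:E).
Proof. by move=> f2 g2; exact/(Lfun1_integrable mu (f \* g))/Lfun2_mul_Lfun1. Qed.

Lemma integral_mul_L2dot f g : f \in Lfun mu 2%:E -> g \in Lfun mu 2%:E ->
  (\int[mu]_x (f x * g x)%:E = (L2dot f g)%:E)%E.
Proof.
move=> f2 g2; rewrite /L2dot /Rintegral fineK//.
by apply: integrable_fin_num => //; exact: integrable_mul_Lfun2.
Qed.

Lemma L2dot_ge0 f : 0 <= L2dot f f.
Proof. by apply: Rintegral_ge0 => x _; rewrite -expr2 sqr_ge0. Qed.

Lemma L2dotC f g : L2dot f g = L2dot g f.
Proof. by apply: eq_Rintegral => x _; rewrite mulrC. Qed.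

Lemma L2dot_linearl f g h c :
  f \in Lfun mu 2%:E -> g \in Lfun mu 2%:E -> h \in Lfun mu 2%:E ->
  L2dot (fun x => f x + c * g x) h = L2dot f h + c * L2dot g h.
Proof.
move=> f2 g2 h2.
have fh := integrable_mul_Lfun2 f2 h2; have gh := integrable_mul_Lfun2 g2 h2.
rewrite /L2dot -RintegralZl// -(RintegralD measurableT fh (integrableZl measurableT c gh)).
by apply: eq_Rintegral => x _; rewrite mulrDl mulrA.
Qed.

Lemma L2dot_linear_sqr f g c : f \in Lfun mu 2%:E -> g \in Lfun mu 2%:E ->
  L2dot (fun x => f x + c * g x) (fun x => f x + c * g x) =
  L2dot f f + 2 * c * L2dot f g + c ^+ 2 * L2dot g g.
Proof.
move=> f2 g2; have fg2 := Lfun2_linear c f2 g2.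
rewrite L2dot_linearl// (L2dotC f (fun x => _)) (L2dotC g (fun x => _)).
by rewrite !(L2dot_linearl c f2 g2)// (L2dotC g f); ring.
Qed.

Lemma L2dotB_sqr f g : f \in Lfun mu 2%:E -> g \in Lfun mu 2%:E ->
  L2dot (fun x => f x - g x) (fun x => f x - g x) =
  L2dot f f - 2 * L2dot f g + L2dot g g.
Proof.
move=> f2 g2; have := L2dot_linear_sqr (-1) f2 g2.
by rewrite mulrN1 mulNr sqrrN expr1n mul1r; under eq_fun do rewrite mulN1r.
Qed.

Lemma L2dot_CauchySchwarz f g : f \in Lfun mu 2%:E -> g \in Lfun mu 2%:E ->
  (L2dot f g) ^+ 2 <= L2dot f f * L2dot g g.
Proof.
move=> f2 g2.
have quadratic_ge0 c : 0 <= L2dot f f + 2 * c * L2dot f g + c ^+ 2 * L2dot g g.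
  by rewrite -L2dot_linear_sqr// L2dot_ge0.
have := L2dot_ge0 g; rewrite le_eqVlt => /predU1P[gg0|gg_gt0].
  suff -> : L2dot f g = 0 by rewrite -gg0 expr0n mulr0.
  apply: contra_eq (erefl true) => fg0.
  have := quadratic_ge0 (- (L2dot f f + 1) / (2 * L2dot f g)).
  by rewrite -gg0 mulr0 addr0 mulrAC mulrCA mulfV ?mulf_neq0// mulr1; lra.
have := quadratic_ge0 (- L2dot f g / L2dot g g).
rewrite -(pmulr_rge0 _ gg_gt0) (_ : L2dot g g * _ = L2dot f f * L2dot g g - L2dot f g ^+ 2).
  by rewrite subr_ge0.
by field; rewrite gt_eqF.
Qed.

Definition L2_cvg F f : Prop :=
  (\int[mu]_x ((F n x - f x) ^+ 2)%:E)%E @[n --> \oo] --> 0%E.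

Lemma integral_sqr_linear_le f g c :
  measurable_fun setT f -> measurable_fun setT g ->
  (\int[mu]_x ((f x + c * g x) ^+ 2)%:E <=
    2%:E * \int[mu]_x ((f x) ^+ 2)%:E + (2 * c ^+ 2)%:E * \int[mu]_x ((g x) ^+ 2)%:E)%E.
Proof.
move=> mf mg.
have msqr h : measurable_fun setT h -> measurable_fun setT (fun x => ((h x) ^+ 2)%:E).
  by move=> mh; apply/measurable_EFinP; exact: measurable_funX.
have sqr0 h (x : T) : (0 <= ((h x) ^+ 2)%:E)%E by rewrite lee_fin sqr_ge0.
have c2_ge0 : (0 <= (2 * c ^+ 2)%:E)%E by rewrite lee_fin mulr_ge0 ?sqr_ge0.
rewrite -!ge0_integralZl//; do ?exact: msqr.
rewrite -ge0_integralD//; do ?(by move=> x _; exact: mule_ge0);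
  do ?by apply: measurable_funeM; exact: msqr.
apply: ge0_le_integral => //.
- by move=> x _; rewrite lee_fin sqr_ge0.
- by apply: msqr; apply: measurable_funD => //; exact: measurable_funM.
- by apply: emeasurable_funD; apply: measurable_funeM; exact: msqr.
move=> x _; rewrite -!EFinM -EFinD lee_fin -subr_ge0.
by rewrite (_ : _ - _ = (f x - c * g x) ^+ 2) ?sqr_ge0//; ring.
Qed.

Lemma L2_cvg_linear F G f g c :
  (forall n, measurable_fun setT (F n)) -> (forall n, measurable_fun setT (G n)) ->
  measurable_fun setT f -> measurable_fun setT g ->
  L2_cvg F f -> L2_cvg G g ->
  L2_cvg (fun n x => F n x + c * G n x) (fun x => f x + c * g x).
Proof.
move=> mF mG mf mg Ff Gg.
apply: (@squeeze_cvge _ _ _ _ (cst 0%E) _ (fun n =>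
   2%:E * \int[mu]_x ((F n x - f x) ^+ 2)%:E +
   (2 * c ^+ 2)%:E * \int[mu]_x ((G n x - g x) ^+ 2)%:E)%E); last 2 first.
- exact: cvg_cst.
- rewrite [X in _ --> X](_ : _ = 2%:E * 0 + (2 * c ^+ 2)%:E * 0)%E; last by rewrite !mule0 adde0.
  by apply: cvgeD; [rewrite !mule0|exact: cvgeZl|exact: cvgeZl].
apply: nearW => n; apply/andP; split.
  by apply: integral_ge0 => x _; rewrite lee_fin sqr_ge0.
have -> : (fun x => ((F n x + c * G n x - (f x + c * g x)) ^+ 2)%:E) =
    (fun x => ((F n x - f x + c * (G n x - g x)) ^+ 2)%:E).
  by apply/funext => x; congr (_ ^+ 2)%:E; ring.
by apply: integral_sqr_linear_le; exact: measurable_funB.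
Qed.

Lemma L2_cvg_Lfun2 F f : (forall n, F n \in Lfun mu 2%:E) -> measurable_fun setT f ->
  L2_cvg F f -> f \in Lfun mu 2%:E.
Proof.
move=> F2 mf Ff.
have /fine_cvgP[[N _ /(_ N (leqnn N)) /fin_numPlt/andP[_ D2]] _] := Ff.
rewrite (_ : f = fun x => F N x - (F N x - f x)); last by apply/funext => x; rewrite subKr.
apply: Lfun2B => //; apply/Lfun2P; split=> //.
by apply: measurable_funB => //; have /Lfun2P[] := F2 N.
Qed.

Lemma L2_cvg_sqr F f : (forall n, F n \in Lfun mu 2%:E) -> measurable_fun setT f ->
  L2_cvg F f -> L2dot (F n) (F n) @[n --> \oo] --> L2dot f f.
Proof.
move=> F2 mf Ff; have f2 := L2_cvg_Lfun2 F2 mf Ff.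
pose D n x := F n x - f x.
have D2 n : D n \in Lfun mu 2%:E by exact: Lfun2B.
have DD0 : L2dot (D n) (D n) @[n --> \oo] --> (0 : R) by exact: (fine_cvg Ff).
have sqFE n : L2dot (F n) (F n) = L2dot f f + 2 * L2dot f (D n) + L2dot (D n) (D n).
  have := L2dot_linear_sqr 1 f2 (D2 n); rewrite mulr1 expr1n mul1r => <-.
  by congr L2dot; apply/funext => x; rewrite mul1r addrC subrK.
have fD0 : L2dot f (D n) @[n --> \oo] --> (0 : R).
  apply: norm_cvg0.
  apply: (@squeeze_cvgr _ _ _ _ (cst 0) (fun n => Num.sqrt (L2dot f f * L2dot (D n) (D n)))).
  - by near=> n; rewrite normr_ge0/= -sqrtr_sqr ler_wsqrtr// L2dot_CauchySchwarz.
  - exact: cvg_cst.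
  - rewrite -[X in _ --> X](sqrtr0 R) -(mulr0 (L2dot f f)).
    by apply: continuous_cvg; [exact: sqrt_continuous|exact: cvgMl_tmp].
under eq_fun do rewrite sqFE.
rewrite -[X in nbhs X](addr0 (L2dot f f)) -[X in nbhs (X + _)](addr0 (L2dot f f)).
rewrite -[X in nbhs (_ + X + _)](mulr0 2).
by apply: cvgD => //; apply: cvgD; [exact: cvg_cst|exact: cvgMl_tmp].
Unshelve. all: by end_near. Qed.

End square_integrable.

(** * Integration by antiderivatives *)

Section antiderivative.
Context {R : realType}.
Local Notation mu := (@lebesgue_measure R).
Implicit Types (f g F : R -> R) (a b x : R).

Lemma is_derive_continuous F x l : is_derive x (1 : R) F l -> {for x, continuous F}.
Proof. by case=> dF _; exact/differentiable_continuous/derivable1_diffP. Qed.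

Lemma integral_itv_is_derive f F a b : a <= b ->
  (forall x, a <= x <= b -> is_derive x (1 : R) F (f x)) ->
  (forall x, a <= x <= b -> {for x, continuous f}) ->
  (\int[mu]_(x in `[a, b]) (f x)%:E = (F b - F a)%:E)%E.
Proof.
rewrite le_eqVlt => /predU1P[<- _ _|ab dF cf].
  by rewrite set_itv1 integral_set1 subrr.
have aab : a <= a <= b by rewrite lexx ltW.
have abb : a <= b <= b by rewrite lexx ltW.
have openW x : x \in `]a, b[ -> a <= x <= b.
  by rewrite in_itv/= => /andP[ax xb]; rewrite !ltW.
rewrite (continuous_FTC2 ab (F := F))//.
- by apply: continuous_in_subspaceT => x; rewrite inE/= in_itv; exact: cf.
- split=> [x /openW /dF[]//| |].
    exact/cvg_at_right_filter/(is_derive_continuous (dF _ aab)).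
  exact/cvg_at_left_filter/(is_derive_continuous (dF _ abb)).
- by move=> x /openW /dF ?; rewrite derive1E; exact: derive_val.
Qed.

Definition centered_itv (n : nat) : set R := `[- n.+1%:R, n.+1%:R]%classic.

Lemma ge0_cvgn_integral_centered_itv f : measurable_fun setT f -> (forall x, 0 <= f x) ->
  (\int[mu]_(x in centered_itv n) (f x)%:E)%E @[n --> \oo] --> (\int[mu]_x (f x)%:E)%E.
Proof.
move=> mf f0; have UA : \bigcup_n centered_itv n = setT.
  apply/seteqP; split=> // x _; exists (Num.truncn `|x|) => //.
  by rewrite /centered_itv/= in_itv/= -ler_norml; apply: ltW; exact: truncnS_gt.
rewrite -UA; apply: ge0_nondecreasing_set_cvg_integral => //.
- apply/nondecreasing_seqP => n; apply/subsetPset => x.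
  rewrite /centered_itv/= !in_itv/= => /andP[nx xn].
  by rewrite (le_trans _ nx) ?(le_trans xn)// ?lerN2 ler_nat.
- by move=> n; exact: measurable_itv.
- by move=> n; apply: measurable_funTS; exact/measurable_EFinP.
- by move=> n x _; rewrite lee_fin.
Qed.

Lemma ge0_integralT_is_derive f g F a b v :
  (forall x, 0 <= f x) -> (forall x, 0 <= g x) -> continuous f -> continuous g ->
  (forall x, is_derive x (1 : R) F (f x - g x)) ->
  F n%:R @[n --> \oo] --> b -> F (- n%:R) @[n --> \oo] --> a ->
  (\int[mu]_x (g x)%:E = v%:E)%E -> (\int[mu]_x (f x)%:E = (v + (b - a))%:E)%E.
Proof.
move=> f0 g0 cf cg dF Fb Fa gv.
have mf := continuous_measurable_fun cf; have mg := continuous_measurable_fun cg.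
apply: (cvg_unique _ (ge0_cvgn_integral_centered_itv mf f0)) => //.
have fE n : (\int[mu]_(x in centered_itv n) (f x)%:E =
    \int[mu]_(x in centered_itv n) (g x)%:E + (F n.+1%:R - F (- n.+1%:R))%:E)%E.
  have ab : - n.+1%:R <= n.+1%:R :> R by rewrite (@le_trans _ _ 0)// oppr_le0.
  have int h : continuous h -> mu.-integrable (centered_itv n) (EFin \o h).
    move=> ch; apply: continuous_compact_integrable; first exact: segment_compact.
    exact: continuous_subspaceT.
  have cfg : continuous (fun x => f x - g x) by move=> x; apply: cvgB; [exact: cf|exact: cg].
  rewrite -(integral_itv_is_derive ab (fun x _ => dF x) (fun x _ => cfg x)).
  under [X in (_ + X)%E]eq_integral do rewrite EFinB.
  rewrite integralB_EFin//; [|exact: int|exact: int].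
  have fin_g : (\int[mu]_(x in centered_itv n) (g x)%:E)%E \is a fin_num.
    by apply: (integrable_fin_num _ (int _ cg)); exact: measurable_itv.
  by rewrite addeCA subee ?adde0.
rewrite (_ : (fun n => _) = fun n => (\int[mu]_(x in centered_itv n) (g x)%:E +
    (F n.+1%:R - F (- n.+1%:R))%:E)%E); last exact/funext.
rewrite EFinD; apply: cvgeD => //.
  by rewrite -gv; exact: ge0_cvgn_integral_centered_itv.
apply: cvg_EFin; first exact: nearW.
apply: cvgB; first by rewrite (cvg_shiftS (fun n => F n%:R)).
by rewrite (cvg_shiftS (fun n => F (- n%:R))).
Qed.

End antiderivative.

(** * Gaussian random variables *)

Lemma ge0_integral_density (d : measure_display) (T : measurableType d) (R : realType)
    (mu : {sigma_finite_measure set T -> \bar R}) (nu : {finite_measure set T -> \bar R})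
    (p : T -> \bar R) :
  mu.-integrable setT p -> (forall A, measurable A -> nu A = \int[mu]_(x in A) p x)%E ->
  forall f : T -> \bar R, measurable_fun setT f -> (forall x, 0 <= f x)%E ->
  (\int[nu]_x f x = \int[mu]_x (f x * p x))%E.
Proof.
move=> ip nuE f mf f0.
have nu_mu : nu `<< mu.
  apply/null_content_dominatesP => A mA muA0; rewrite nuE//.
  by apply: null_set_integral => //; exact: measurable_funTS (measurable_int mu ip).
rewrite -(Radon_Nikodym_SigmaFinite.change_of_variables nu_mu f0 measurableT mf).
have iRN := Radon_Nikodym_SigmaFinite.f_integrable nu_mu.
apply: ae_eq_integral => //.
- by apply: emeasurable_funM => //; exact: measurable_int iRN.
- by apply: emeasurable_funM => //; exact: measurable_int ip.
- apply: ae_eqe_mul2l; apply: integral_ae_eq => //; first exact: measurable_int ip.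
  by move=> A _ mA; rewrite -nuE// -Radon_Nikodym_SigmaFinite.f_integral.
Qed.

Section normal_distribution.
Context {R : realType}.
Local Notation mu := (@lebesgue_measure R).
Implicit Types m s c x : R.

Lemma emeasurable_normal_pdf m s (B : set (measurableTypeR R)) :
  measurable_fun B (fun x : measurableTypeR R => (normal_pdf m s x)%:E).
Proof. by apply: measurable_funTS; exact: measurable_int (integrable_normal_pdf m s). Qed.

Lemma ge0_integral_normal_prob m s (f : R -> \bar R) :
  measurable_fun setT f -> (forall x, 0 <= f x)%E ->
  (\int[normal_prob m s]_x f x = \int[mu]_x (f x * (normal_pdf m s x)%:E))%E.
Proof.
have := @ge0_integral_density _ _ R mu (normal_prob m s) _ (integrable_normal_pdf m s).
by apply.
Qed.

Lemma cvg_normal_fun_infty s c (t : nat -> R) : s != 0 -> (`|t n|) @[n --> \oo] --> +oo ->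
  (t n + c) * normal_fun 0 s (t n) @[n --> \oo] --> (0 : R).
Proof.
move=> s0 ty.
have Vt : `|t n|^-1 @[n --> \oo] --> (0 : R).
  by apply/gtr0_cvgV0 => //; near=> n; near: n; move/cvgryPgt: ty; apply.
apply: norm_cvg0.
apply: (@squeeze_cvgr _ _ _ _ (cst 0)
  (fun n => (s ^+ 2 *+ 2) * (`|t n|^-1 + `|c| * (`|t n|^-1 * `|t n|^-1)))).
- near=> n; rewrite normr_ge0/= normrM (@ger0_norm _ (normal_fun _ _ _)) ?normal_fun_ge0//.
  have t0 : 0 < `|t n| by near: n; move/cvgryPgt: ty; apply.
  have s2 : 0 < s ^+ 2 *+ 2 by rewrite mulrn_wgt0// exprn_even_gt0.
  have fun_le : normal_fun 0 s (t n) <= (s ^+ 2 *+ 2) / `|t n| ^+ 2.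
    rewrite /normal_fun subr0 mulNr expRN real_normK ?num_real//.
    rewrite -[leRHS]invf_div lef_pV2 ?posrE ?expR_gt0 ?divr_gt0//; last first.
      by rewrite -real_normK ?num_real ?exprn_gt0.
    by rewrite (le_trans _ (expR_ge1Dx _))// lerDr.
  apply: (le_trans (ler_wpM2l (normr_ge0 _) fun_le)).
  apply: (le_trans (ler_wpM2r _ (ler_normD _ _))); first by rewrite divr_ge0 ?sqr_ge0 ?ltW.
  by rewrite le_eqVlt; apply/predU1P; left; field; rewrite gt_eqF.
- exact: cvg_cst.
- rewrite -(mulr0 (s ^+ 2 *+ 2)); apply: cvgMl_tmp; rewrite -[X in _ --> X](addr0 0).
  apply: cvgD => //; rewrite -[X in _ --> X](mulr0 `|c|); apply: cvgMl_tmp.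
  by rewrite -[X in _ --> X](mulr0 0); exact: cvgM.
Unshelve. all: by end_near. Qed.

(* [(x - c)^2 p = (s^2 + (m - c)^2) p + F'] for the density [p] and
   [F x = - s^2 (x + m - 2 c) p x]. *)
Lemma integral_sqr_normal_pdf m s c : s != 0 ->
  (\int[mu]_x ((x - c) ^+ 2 * normal_pdf m s x)%:E = (s ^+ 2 + (m - c) ^+ 2)%:E)%E.
Proof.
move=> s0; set v := s ^+ 2 + (m - c) ^+ 2.
pose F x := - s ^+ 2 * normal_peak s * ((x - m + (m - c) *+ 2) * normal_fun m s x).
have v0 : 0 <= v by rewrite addr_ge0 ?sqr_ge0.
have cp : continuous (normal_pdf m s) by exact: continuous_normal_pdf.
have cvg_F (t : nat -> R) : (forall n, n%:R - `|m| <= `|t n - m|) ->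
    F (t n) @[n --> \oo] --> (0 : R).
  move=> le_t; have ty : `|t n - m| @[n --> \oo] --> +oo.
    by apply: ger_cvgy (cvg_comp _ _ cvgr_idn (cvg_addrr (- `|m|))); exact: nearW.
  have Ft := cvg_normal_fun_infty ((m - c) *+ 2) s0 ty.
  rewrite -[X in _ --> X](mulr0 (- s ^+ 2 * normal_peak s)); apply: cvgMl_tmp.
  by under eq_fun do rewrite normal_fun_center.
transitivity ((v + (0 - 0))%:E); last by rewrite subr0 addr0.
apply: (@ge0_integralT_is_derive _ _ (fun x => v * normal_pdf m s x) F).
- by move=> x; rewrite mulr_ge0 ?sqr_ge0 ?normal_pdf_ge0.
- by move=> x; rewrite mulr_ge0 ?normal_pdf_ge0.
- move=> x; apply: cvgM; last exact: cp.
  apply: (continuous_comp (f := fun x => x - c) (g := fun x => x ^+ 2)).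
    by apply: cvgB; [exact: cvg_id|exact: cvg_cst].
  exact: exprn_continuous.
- by move=> x; apply: cvgM; [exact: cvg_cst|exact: cp].
- move=> x; rewrite normal_pdfE// /F /normal_fun; apply: is_derive_eq.
  by rewrite /GRing.scale/= /v; field.
- by apply: cvg_F => n; have := lerB_dist n%:R m; rewrite ger0_norm.
- by apply: cvg_F => n; rewrite -opprD normrN; have := lerB_normD n%:R m; rewrite ger0_norm.
- under eq_integral do rewrite EFinM.
  by rewrite integralZl ?integral_normal_pdf ?mule1//; exact: integrable_normal_pdf.
Qed.

Lemma exp_sqr_normal_pdf s x : 0 < s ->
  expR (x ^+ 2 / (4 * s ^+ 2)) * normal_pdf 0 s x = Num.sqrt 2 * normal_pdf 0 (Num.sqrt 2 * s) x.
Proof.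
move=> s0; have s'0 : 0 < Num.sqrt 2 * s by rewrite mulr_gt0 ?sqrtr_gt0.
have s'_sqr : (Num.sqrt 2 * s) ^+ 2 = 2 * s ^+ 2 by rewrite exprMn sqr_sqrtr.
have peakE : normal_peak s = Num.sqrt 2 * normal_peak (Num.sqrt 2 * s).
  rewrite /normal_peak s'_sqr (_ : 2 * s ^+ 2 * pi *+ 2 = 2 * (s ^+ 2 * pi *+ 2)); last by ring.
  by rewrite sqrtrM// invfM mulrA mulfV ?mul1r.
rewrite !normal_pdfE ?gt_eqF// peakE mulrCA -mulrA; congr (_ * (_ * _)).
by rewrite /normal_fun !subr0 -expRD s'_sqr; congr expR; field; rewrite gt_eqF.
Qed.

End normal_distribution.

Section gaussian_rv.
Context (R : realType) (d : measure_display) (Om : measurableType d).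
Variable Prob : probability Om R.
Implicit Types (X : Om -> R) (m c a : R).

Lemma ge0_integral_law (X : Om -> measurableTypeR R)
    (nu : {measure set (measurableTypeR R) -> \bar R}) :
  measurable_fun setT X ->
  (forall B : set (measurableTypeR R), measurable B -> Prob (X @^-1` B) = nu B) ->
  forall f : measurableTypeR R -> \bar R, measurable_fun setT f -> (forall x, 0 <= f x)%E ->
  (\int[Prob]_w f (X w) = \int[nu]_x f x)%E.
Proof.
move=> mX lawX f mf f0.
pose X' : {mfun Om >-> measurableTypeR R} := HB.pack X (isMeasurableFun.Build _ _ _ _ X mX).
rewrite -[LHS]/(\int[Prob]_w (f \o X') w)%E -(@ge0_integral_distribution _ _ _ _ _ Prob X')//.
by apply: eq_measure_integral => A mA _; exact: lawX.
Qed.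

Lemma ge0_integral_gaussian_rv0 X m (f : R -> \bar R) : gaussian_rv Prob X m 0 ->
  measurable_fun setT f -> (forall x, 0 <= f x)%E -> (\int[Prob]_w f (X w) = f m)%E.
Proof.
move=> [mX lawX] mf f0.
rewrite (@ge0_integral_law X (\d_(m : measurableTypeR R)) mX _ f)//.
  by rewrite integral_dirac// diracT mul1e.
by move=> B mB; rewrite lawX// eqxx.
Qed.

Lemma ge0_integral_gaussian_rv X m s2 (f : R -> \bar R) : 0 < s2 -> gaussian_rv Prob X m s2 ->
  measurable_fun setT f -> (forall x, 0 <= f x)%E ->
  (\int[Prob]_w f (X w) = \int[lebesgue_measure]_x (f x * (normal_pdf m (Num.sqrt s2) x)%:E))%E.
Proof.
move=> s2_gt0 [mX lawX] mf f0.
rewrite (@ge0_integral_law X (normal_prob m (Num.sqrt s2)) mX _ f)//.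
  exact: ge0_integral_normal_prob.
by move=> B mB; rewrite lawX// gt_eqF.
Qed.

Lemma gaussian_rv_sqr X m s2 c : 0 <= s2 -> gaussian_rv Prob X m s2 ->
  (\int[Prob]_w ((X w - c) ^+ 2)%:E = (s2 + (m - c) ^+ 2)%:E)%E.
Proof.
move=> s2_ge0 gX; pose f (x : R) := ((x - c) ^+ 2)%:E.
have mf : measurable_fun setT f by apply/measurable_EFinP/measurable_funX/measurable_funB.
have f0 x : (0 <= f x)%E by rewrite lee_fin sqr_ge0.
rewrite -[LHS]/(\int[Prob]_w f (X w))%E.
have [s20|s2N0] := eqVneq s2 0.
  by rewrite s20 in gX *; rewrite (ge0_integral_gaussian_rv0 gX)// add0r.
have s2_gt0 : 0 < s2 by rewrite lt_neqAle eq_sym s2N0.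
rewrite (ge0_integral_gaussian_rv s2_gt0 gX)//.
rewrite -[in RHS](sqr_sqrtr s2_ge0) -integral_sqr_normal_pdf//.
by rewrite gt_eqF// sqrtr_gt0.
Qed.

Lemma gaussian_rv_Lfun2 X m s2 : 0 <= s2 -> gaussian_rv Prob X m s2 -> X \in Lfun Prob 2%:E.
Proof.
move=> s2_ge0 gX; apply/Lfun2P; split; first by case: gX.
rewrite (eq_integral (fun w => ((X w - 0) ^+ 2)%:E)); last by move=> w _; rewrite subr0.
by rewrite (gaussian_rv_sqr _ s2_ge0 gX) ltry.
Qed.

Lemma gaussian_rv_L2dot X s2 : 0 <= s2 -> gaussian_rv Prob X 0 s2 -> L2dot Prob X X = s2.
Proof.
move=> s2_ge0 gX; have X2 := gaussian_rv_Lfun2 s2_ge0 gX.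
apply: EFin_inj; rewrite -integral_mul_L2dot//.
have := gaussian_rv_sqr 0 s2_ge0 gX; rewrite subr0 expr0n addr0 => <-.
by apply: eq_integral => w _; rewrite subr0.
Qed.

Lemma gaussian_rv_mean X m s2 : 0 <= s2 -> gaussian_rv Prob X m s2 ->
  (\int[Prob]_w (X w)%:E = m%:E)%E.
Proof.
move=> s2_ge0 gX; have [mX _] := gX.
have sqr_int (c : R) : Prob.-integrable setT (fun w => ((X w - c) ^+ 2)%:E).
  apply/integrableP; split; first by apply/measurable_EFinP/measurable_funX/measurable_funB.
  under eq_integral do rewrite gee0_abs ?lee_fin ?sqr_ge0//.
  by rewrite (gaussian_rv_sqr _ s2_ge0 gX) ltry.
have half_int := integrableZl measurableT 2^-1 (integrableB measurableT (sqr_int 0) (sqr_int 1)).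
transitivity (\int[Prob]_w
    (2^-1%:E * (((X w - 0) ^+ 2)%:E - ((X w - 1) ^+ 2)%:E) + cst 2^-1%:E w))%E.
  by apply: eq_integral => w _; rewrite -EFinB -EFinM -EFinD; congr EFin; field.
rewrite integralD//; last exact: finite_measure_integrable_cst.
rewrite integralZl//; last exact: integrableB (sqr_int 0) (sqr_int 1).
rewrite integralB; [|by []|exact: sqr_int|exact: sqr_int].
rewrite !(gaussian_rv_sqr _ s2_ge0 gX) integral_cst//.
rewrite [X in (_ + _ * X)%E](_ : _ = 1%E) ?mule1; last exact: probability_setT.
by rewrite -EFinB -EFinM -EFinD; congr EFin; field.
Qed.

Lemma gaussian_rv_exp_sqr_le X s2 t2 : 0 <= s2 -> s2 <= t2 -> 0 < t2 ->
  gaussian_rv Prob X 0 s2 ->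
  (\int[Prob]_w (expR ((X w) ^+ 2 / (4 * t2)))%:E <= (Num.sqrt 2)%:E)%E.
Proof.
move=> s2_ge0 s2_le t2_gt0 gX; pose f (x : R) := (expR (x ^+ 2 / (4 * t2)))%:E.
have mf : measurable_fun setT f.
  by apply/measurable_EFinP/measurableT_comp => //; exact: measurable_funM.
have f0 x : (0 <= f x)%E by rewrite lee_fin expR_ge0.
rewrite -[leLHS]/(\int[Prob]_w f (X w))%E.
have [s20|s2N0] := eqVneq s2 0.
  rewrite s20 in gX; rewrite (ge0_integral_gaussian_rv0 gX)// /f expr0n mul0r expR0 lee_fin.
  by rewrite -[leLHS]sqrtr1 ler_wsqrtr// ler1n.
have s2_gt0 : 0 < s2 by rewrite lt_neqAle eq_sym s2N0.
rewrite (ge0_integral_gaussian_rv s2_gt0 gX)//; set s := Num.sqrt s2.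
have s_gt0 : 0 < s by rewrite sqrtr_gt0.
apply: (@le_trans _ _ (\int[lebesgue_measure]_x
    ((Num.sqrt 2)%:E * (normal_pdf 0 (Num.sqrt 2 * s) x)%:E))%E).
  apply: ge0_le_integral => //.
  - by move=> x _; rewrite mule_ge0// lee_fin normal_pdf_ge0.
  - by apply: emeasurable_funM; [exact: mf|exact: emeasurable_normal_pdf].
  - by apply: measurable_funeM; exact: emeasurable_normal_pdf.
  move=> x _; rewrite -!EFinM -exp_sqr_normal_pdf// lee_fin ler_wpM2r ?normal_pdf_ge0//.
  rewrite ler_expR sqr_sqrtr// ler_wpM2l ?sqr_ge0//.
  by rewrite lef_pV2 ?posrE ?mulr_gt0// ler_pM2l.
rewrite ge0_integralZl//=.
- by rewrite integral_normal_pdf mule1.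
- exact: emeasurable_normal_pdf.
- by move=> x _; rewrite lee_fin normal_pdf_ge0.
Qed.

Lemma gaussian_rv_tail X s2 t2 a : 0 <= s2 -> s2 <= t2 -> 0 < t2 -> 0 < a ->
  gaussian_rv Prob X 0 s2 ->
  (Prob [set w | (a <= `|X w|)%R] <= (Num.sqrt 2 * expR (- (a ^+ 2 / (4 * t2))))%:E)%E.
Proof.
move=> s2_ge0 s2_le t2_gt0 a_gt0 gX; have [mX _] := gX.
pose X' : {RV Prob >-> R} := HB.pack X (isMeasurableFun.Build _ _ _ _ X mX).
pose f (x : R) := expR (x ^+ 2 / (4 * t2)).
have mf : measurable_fun setT f by apply: measurableT_comp => //; exact: measurable_funM.
have nd_f : {in Num.nneg &, {homo f : x y / x <= y}}.
  move=> x y; rewrite !nnegrE => x0 y0 xy.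
  by rewrite ler_expR ler_wpM2r ?invr_ge0 ?mulr_ge0 ?(ltW t2_gt0)// lerXn2r.
have := markov X' a_gt0 mf (fun x _ => expR_ge0 _) nd_f.
rewrite expRN EFinM lee_pdivlMr ?expR_gt0// muleC => /le_trans; apply.
rewrite unlock; apply: le_trans (gaussian_rv_exp_sqr_le s2_ge0 s2_le t2_gt0 gX).
rewrite le_eqVlt; apply/predU1P; left; apply: eq_integral => w _ /=.
by rewrite /f real_normK ?num_real.
Qed.

End gaussian_rv.

Section normal_limits.
Context {R : realType}.
Local Notation mu := (@lebesgue_measure R).
Implicit Types (m s v x a e : R) (B : set (measurableTypeR R)).

Lemma normal_pdf_sqrtE m v x : 0 < v ->
  normal_pdf m (Num.sqrt v) x = (Num.sqrt (v * (pi *+ 2)))^-1 * expR (- (x - m) ^+ 2 / (v * 2)).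
Proof.
move=> v0; rewrite normal_pdfE ?gt_eqF ?sqrtr_gt0//.
by rewrite /normal_peak /normal_fun sqr_sqrtr ?ltW// -mulrnAr (mulr_natr v 2).
Qed.

Lemma normal_pdf_sqrt_le m v w x : 0 < w -> w / 2 <= v -> v <= 2 * w ->
  normal_pdf m (Num.sqrt v) x <= 2 * normal_pdf m (Num.sqrt (2 * w)) x.
Proof.
move=> w0 wv vw; have v0 : 0 < v by rewrite (lt_le_trans _ wv)// divr_gt0.
have pi2 : 0 < pi *+ 2 :> R by rewrite mulrn_wgt0// pi_gt0.
rewrite !normal_pdf_sqrtE ?mulr_gt0// mulrA; apply: ler_pM; rewrite ?expR_ge0 ?invr_ge0//.
  have -> : 2 * w * (pi *+ 2) = 2 ^+ 2 * (w / 2 * (pi *+ 2)) by field.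
  rewrite (sqrtrM (w / 2 * (pi *+ 2)) (sqr_ge0 2)) sqrtr_sqr ger0_norm//.
  rewrite invfM mulrA mulfV// mul1r lef_pV2 ?posrE ?sqrtr_gt0 ?mulr_gt0 ?invr_gt0//.
  by rewrite ler_wsqrtr// ler_pM2r.
rewrite ler_expR !mulNr lerN2 ler_wpM2l ?sqr_ge0//.
by rewrite lef_pV2 ?posrE ?mulr_gt0// ler_pM2r.
Qed.

Lemma cvg_normal_pdf_sqrt (u : nat -> R) m v x : 0 < v -> (forall n, 0 < u n) ->
  u @ \oo --> v -> normal_pdf m (Num.sqrt (u n)) x @[n --> \oo] --> normal_pdf m (Num.sqrt v) x.
Proof.
move=> v0 u0 uv; rewrite normal_pdf_sqrtE//; under eq_fun do rewrite normal_pdf_sqrtE//.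
have cvg_scaled (c : R) : u n * c @[n --> \oo] --> v * c by apply: cvgM => //; exact: cvg_cst.
apply: cvgM.
  apply: cvgV; first by rewrite gt_eqF// sqrtr_gt0 mulr_gt0// mulrn_wgt0// pi_gt0.
  by apply: continuous_cvg; [exact: sqrt_continuous|exact: cvg_scaled].
apply: continuous_cvg; first exact: continuous_expR.
apply: cvgM; first exact: cvg_cst.
by apply: cvgV; [rewrite gt_eqF// mulr_gt0|exact: cvg_scaled].
Qed.

Lemma cvg_normal_prob (u : nat -> R) m v B : 0 < v -> u @ \oo --> v -> measurable B ->
  normal_prob m (Num.sqrt (u n)) B @[n --> \oo] --> normal_prob m (Num.sqrt v) B.
Proof.
move=> v0 uv mB.
have [N _ near_v] : \forall n \near \oo, v / 2 <= u n <= 2 * v.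
  near=> n; apply/andP; split; near: n.
    by apply: (cvgr_ge _ uv); lra.
  by apply: (cvgr_le _ uv); lra.
have uN n : v / 2 <= u (n + N)%N <= 2 * v by apply: near_v; rewrite /= leq_addl.
have uN0 n : 0 < u (n + N)%N by case/andP: (uN n) => /(lt_le_trans _) -> //; rewrite divr_gt0.
have uNv : u (n + N)%N @[n --> \oo] --> v by rewrite (cvg_shiftn N).
rewrite -(cvg_shiftn N).
have [|||||_ _ //] := @dominated_convergence _ _ R mu B mB
  (fun n x => (normal_pdf m (Num.sqrt (u (n + N)%N)) x)%:E)
  (fun x => (normal_pdf m (Num.sqrt v) x)%:E)
  (fun x => 2%:E * (normal_pdf m (Num.sqrt (2 * v)) x)%:E)%E.
- by move=> n; exact: emeasurable_normal_pdf.
- exact: emeasurable_normal_pdf.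
- apply: aeW => x _; apply: cvg_EFin; first exact: nearW.
  exact: cvg_normal_pdf_sqrt.
- apply: integrableZl => //; apply: (integrableS measurableT) => //.
  exact: integrable_normal_pdf.
- apply: aeW => x n _ /=; rewrite -EFinM lee_fin ger0_norm ?normal_pdf_ge0//.
  by case/andP: (uN n) => *; exact: normal_pdf_sqrt_le.
Unshelve. all: by end_near. Qed.

Lemma normal_prob_itvoc_le m s a e : s != 0 -> 0 < e ->
  (normal_prob m s `]a, (a + e)%R] <= (normal_peak s * e)%:E)%E.
Proof.
move=> s0 e0.
apply: (@le_trans _ _ (\int[mu]_(x in `]a, (a + e)%R]) (cst (normal_peak s)%:E) x)%E).
  apply: ge0_le_integral => //=.
  - by move=> x _; rewrite lee_fin normal_pdf_ge0.
  - exact: emeasurable_normal_pdf.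
  - by move=> x _; rewrite lee_fin normal_pdf_ub.
rewrite integral_cst//= lebesgue_measure_itv/= lte_fin ltrDl e0 -EFinB -EFinM lee_fin.
by rewrite addrC addKr.
Qed.

Definition normal_tail m s a : R := fine (normal_prob m s `]a, +oo[).

Lemma normal_tail_itvoc m s a e : 0 <= e ->
  (normal_prob m s `]a, (a + e)%R] = (normal_tail m s a - normal_tail m s (a + e))%:E)%E.
Proof.
move=> e0; have fin b : normal_prob m s `]b, +oo[ \is a fin_num by exact: fin_num_measure.
rewrite EFinB !fineK//.
rewrite [X in (X - _)%E](_ : _ =
    normal_prob m s `]a, (a + e)%R] + normal_prob m s `](a + e)%R, +oo[)%E.
  by rewrite addeK.
rewrite -measureU//.
- by rewrite -itv_bndbnd_setU// bnd_simp lerDl.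
- apply/seteqP; split=> // x [] /=; rewrite !in_itv/= andbT => /andP[_ xa] /(le_lt_trans xa).
  by rewrite ltxx.
Qed.

Lemma normal_tail_lipschitz m s a b : s != 0 ->
  `|normal_tail m s a - normal_tail m s b| <= normal_peak s * `|a - b|.
Proof.
move=> s0; wlog ab : a b / a < b => [wlog_lt|].
  have [/wlog_lt//|/wlog_lt|->] := ltgtP a b.
    by rewrite !(distrC _ a) (distrC (normal_tail _ _ b)).
  by rewrite !subrr !normr0 mulr0.
have e0 : 0 < b - a by rewrite subr_gt0.
have := normal_prob_itvoc_le m a s0 e0.
have := normal_tail_itvoc m s a (ltW e0).
rewrite subrKC => tailE; rewrite tailE lee_fin (distrC a) (gtr0_norm e0) ger0_norm//.
by rewrite -lee_fin -tailE measure_ge0.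
Qed.

Lemma continuous_normal_tail m s a : s != 0 -> {for a, continuous (normal_tail m s)}.
Proof.
move=> s0; have peak0 : 0 < normal_peak s by exact: normal_peak_gt0.
apply/cvgrPdist_le => e e0; near=> b.
rewrite (le_trans (normal_tail_lipschitz _ _ _ s0))// mulrC -ler_pdivlMr//.
by near: b; apply: (cvgrPdist_le _ _).1; [exact: cvg_id|rewrite divr_gt0].
Unshelve. all: by end_near. Qed.

End normal_limits.

Lemma measure_eq_rays (R : realType) (m1 m2 : {measure set (measurableTypeR R) -> \bar R}) :
  (forall a : R, m1 `]a, +oo[%classic < +oo)%E ->
  (forall a : R, m1 `]a, +oo[%classic = m2 `]a, +oo[%classic) ->
  forall B, measurable B -> m1 B = m2 B.
Proof.
move=> fin m12 B mB.
apply: (@measure_unique _ R (measurableTypeR R) [set A | exists x : R, A = `]x, +oo[%classic]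
  (fun n => `]- n%:R, +oo[%classic) _ _ _ _ m1 m2 _ _ B mB) => //.
- exact: RGenOInfty.measurableE.
- move=> _ _ [x ->] [y ->]; exists (Num.max x y).
  by apply/seteqP; split => z /=; rewrite !in_itv/= !andbT gt_max => /andP//.
- by move=> n; exists (- n%:R).
- apply/seteqP; split => // x _; exists (Num.truncn `|x|).+1 => //=.
  rewrite in_itv/= andbT ltrNl (le_lt_trans (ler_norm _))// normrN.
  by exact: truncnS_gt.
- by move=> _ [x ->]; exact: m12.
Qed.

Lemma measurable_preimage (d d' : measure_display) (T : measurableType d)
    (U : measurableType d') (f : T -> U) (B : set U) :
  measurable_fun setT f -> measurable B -> measurable (f @^-1` B).
Proof. by move=> mf mB; rewrite -[X in measurable X]setTI; exact: mf. Qed.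

Lemma measurable_neq (d : measure_display) (T : measurableType d) (R : realType)
    (f g : T -> R) :
  measurable_fun setT f -> measurable_fun setT g -> measurable [set w | f w != g w].
Proof.
move=> mf mg; rewrite -[X in measurable X]setTI.
by apply: (measurable_neqe _ (f := EFin \o f) (g := EFin \o g)) => //; exact/measurable_EFinP.
Qed.

Section L2_limits_of_gaussians.
Context (R : realType) (d : measure_display) (Om : measurableType d).
Variable Prob : probability Om R.
Implicit Types (X Y : Om -> R) (F : nat -> Om -> R) (a e : R).

Lemma measurable_norm_ge X a : measurable_fun setT X -> measurable [set w | (a <= `|X w|)%R].
Proof.
move=> mX; rewrite -[X in measurable X]setTI.
by apply: (measurable_fun_le (f := cst a) (g := fun w => `|X w|)) => //; exact: measurableT_comp.
Qed.

Lemma chebyshev_sqr (mu : {measure set Om -> \bar R}) X e : measurable_fun setT X -> 0 < e ->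
  (mu [set w | (e <= `|X w|)%R] <= (e ^- 2)%:E * \int[mu]_w ((X w) ^+ 2)%:E)%E.
Proof.
move=> mX e0; have e20 : 0 < e ^+ 2 by rewrite exprn_gt0.
have mX2 : measurable_fun setT (fun w => ((X w) ^+ 2)%:E).
  by apply/measurable_EFinP; exact: measurable_funX.
have := @le_integral_abse _ _ _ mu _ measurableT _ _ mX2 e20; rewrite setTI.
have -> : [set w | ((e ^+ 2)%:E <= `|(X w ^+ 2)%:E|)%E] = [set w | (e <= `|X w|)%R].
  by apply/seteqP; split => w /=; rewrite lee_fin normrX ler_sqr// nnegrE ltW.
under eq_integral do rewrite gee0_abs ?lee_fin ?sqr_ge0//.
by rewrite muleC -lee_pdivlMr// muleC.
Qed.

Lemma prob_tail_le X Y a e : measurable_fun setT X -> measurable_fun setT Y -> 0 < e ->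
  (Prob (X @^-1` `](a + e)%R, +oo[) <= Prob (Y @^-1` `]a, +oo[) +
     (e ^- 2)%:E * \int[Prob]_w ((Y w - X w) ^+ 2)%:E)%E.
Proof.
move=> mX mY e0; have mYX : measurable_fun setT (fun w => Y w - X w) by exact: measurable_funB.
apply: le_trans (leeD2l _ (chebyshev_sqr Prob mYX e0)).
have mYa : measurable (Y @^-1` `]a, +oo[) by exact: measurable_preimage.
have mfar := measurable_norm_ge e mYX.
apply: le_trans (measureU2 Prob mYa mfar).
apply: le_measure; rewrite ?inE; [exact: measurable_preimage|exact: measurableU|].
move=> w /=; rewrite !in_itv/= !andbT => aX.
have [far|near] := leP e `|Y w - X w|; [by right|left].
by have := ler_norm (X w - Y w); rewrite distrC; lra.
Qed.

Lemma L2_cvg_prob_tail F X (T : R -> R) a : (forall n, measurable_fun setT (F n)) ->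
  measurable_fun setT X -> L2_cvg Prob F X ->
  (forall b, Prob (F n @^-1` `]b, +oo[) @[n --> \oo] --> (T b)%:E) -> {for a, continuous T} ->
  Prob (X @^-1` `]a, +oo[) = (T a)%:E.
Proof.
move=> mF mX FX FT Ta; set p := Prob _.
have p_fin : p \is a fin_num by apply: fin_num_measure; exact: measurable_preimage.
have scaled_cvg0 (e : R) :
    ((e ^- 2)%:E * \int[Prob]_w ((F n w - X w) ^+ 2)%:E)%E @[n --> \oo] --> 0%E.
  by rewrite -(mule0 (e ^- 2)%:E); exact: cvgeZl.
have le_T e : 0 < e -> fine p <= T (a - e).
  move=> e0; rewrite -lee_fin fineK//.
  have bound_cvg : (Prob (F n @^-1` `](a - e)%R, +oo[) +
      (e ^- 2)%:E * \int[Prob]_w ((F n w - X w) ^+ 2)%:E)%E @[n --> \oo] --> (T (a - e))%:E.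
    by rewrite -[X in _ --> X]adde0; exact: cvgeD.
  apply: (lee_cvg_to (cvg_cst p) bound_cvg); apply: nearW => n.
  by have := prob_tail_le (a - e) mX (mF n) e0; rewrite subrK.
have ge_T e : 0 < e -> T (a + e) <= fine p.
  move=> e0; rewrite -lee_fin fineK//.
  have p_cvg : (p + (e ^- 2)%:E * \int[Prob]_w ((F n w - X w) ^+ 2)%:E)%E @[n --> \oo] --> p.
    rewrite -[X in _ --> X]adde0; apply: cvgeD => //; first exact: fin_num_adde_defr.
    exact: cvg_cst.
  apply: (lee_cvg_to (FT (a + e)) p_cvg); apply: nearW => n.
  have := prob_tail_le a (mF n) mX e0; congr (_ <= _ + _ * _)%E.
  by apply: eq_integral => w _; rewrite -sqrrN opprB.
rewrite -(fineK p_fin); congr EFin; apply/eqP; rewrite -subr_eq0 -normr_le0.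
apply/ler_addgt0Pr => e e0; rewrite add0r.
have /cvgrPdist_le /(_ e e0) /nbhs_ballP[r /= r0 near_a] := Ta.
have r2 : 0 < r / 2 by rewrite divr_gt0.
have near_T b : `|a - b| < r -> `|T a - T b| <= e by exact: near_a.
have := le_T _ r2; have := ge_T _ r2.
have := near_T (a + r / 2); have := near_T (a - r / 2).
rewrite subKr opprD addNKr normrN gtr0_norm// => /(_ _)/[swap] /(_ _).
rewrite !ler_norml ltr_pdivrMr// ltr_pMr// ltr1n => /(_ isT)/andP[_ ?] /(_ isT)/andP[? _].
by move=> *; apply/andP; split; lra.
Qed.

Lemma gaussian_rv_eq0 X : measurable_fun setT X -> (\int[Prob]_w ((X w) ^+ 2)%:E = 0)%E ->
  gaussian_rv Prob X 0 0.
Proof.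
move=> mX X20; split=> // B mB; rewrite eqxx.
have mX2 : measurable_fun setT (fun w => ((X w) ^+ 2)%:E).
  by apply/measurable_EFinP; exact: measurable_funX.
have X0 : \forall w \ae Prob, X w = 0.
  have /(ae_eq_integral_abs Prob measurableT mX2) : (\int[Prob]_w `|((X w) ^+ 2)%:E| = 0)%E.
    by rewrite -X20; apply: eq_integral => w _; rewrite gee0_abs// lee_fin sqr_ge0.
  apply: filterS => w /(_ Logic.I) [] /eqP.
  by rewrite sqrf_eq0 => /eqP.
transitivity (\int[Prob]_w (\1_B (0 : R))%:E)%E; last first.
  by rewrite integral_cst// [X in (_ * X)%E]probability_setT mule1 diracE indicE.
have mXB : measurable (X @^-1` B) by exact: measurable_preimage.
rewrite -(setIT (X @^-1` B)) -integral_indic//.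
apply: ae_eq_integral => //; first exact/measurable_EFinP/measurable_indic.
by apply: filterS X0 => w Xw _; rewrite -[X in \1_B X]Xw !indicE.
Qed.

Lemma gaussian_rv_L2_cvg F X (v : nat -> R) : (forall n, 0 <= v n) ->
  (forall n, gaussian_rv Prob (F n) 0 (v n)) -> measurable_fun setT X -> L2_cvg Prob F X ->
  gaussian_rv Prob X 0 (L2dot Prob X X).
Proof.
move=> v0 gF mX FX.
have F2 n : F n \in Lfun Prob 2%:E by exact: gaussian_rv_Lfun2 (gF n).
have cvg_v : v n @[n --> \oo] --> L2dot Prob X X.
  have := L2_cvg_sqr F2 mX FX.
  by rewrite (_ : (fun n => _) = v)//; apply/funext => n; exact: gaussian_rv_L2dot.
have X2 := L2_cvg_Lfun2 F2 mX FX.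
have := L2dot_ge0 Prob X; rewrite le_eqVlt => /predU1P[X20|X20].
  by rewrite -X20; apply: gaussian_rv_eq0 => //; rewrite (integral_mul_L2dot X2 X2) -X20.
have tail_cvg b : Prob (F n @^-1` `]b, +oo[) @[n --> \oo] -->
    (normal_tail 0 (Num.sqrt (L2dot Prob X X)) b)%:E.
  rewrite fineK ?fin_num_measure//.
  have := @cvg_normal_prob R v 0 _ `]b, +oo[%classic X20 cvg_v (measurable_itv _).
  apply: cvg_trans; apply: near_eq_cvg; near=> n; have [_ ->] := gF n; last exact: measurable_itv.
  by rewrite gt_eqF//; near: n; exact: (cvgr_gt _ cvg_v).
have sqrt_neq0 : Num.sqrt (L2dot Prob X X) != 0 by rewrite gt_eqF// sqrtr_gt0.
split=> // B mB; rewrite gt_eqF//.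
pose X' : {mfun Om >-> measurableTypeR R} :=
  HB.pack X (isMeasurableFun.Build _ _ _ (measurableTypeR R) X mX).
apply: (@measure_eq_rays R (distribution Prob X') (normal_prob 0 _) _ _ B mB) => a.
  by rewrite (le_lt_trans (probability_le1 _ _))// ltry.
have mF n : measurable_fun setT (F n) by case: (gF n).
have := L2_cvg_prob_tail mF mX FX tail_cvg (continuous_normal_tail sqrt_neq0).
by move=> /(_ a); rewrite fineK ?fin_num_measure.
Unshelve. all: by end_near. Qed.

End L2_limits_of_gaussians.

(** * Wiener integrals *)

Import HBNNSimple.

Section step_functions.
Context (R : realType) (d : measure_display) (S : measurableType d).
Variable mu : {measure set S -> \bar R}.
Implicit Types (s t : seq (R * set S)) (f : S -> R) (c : R).

Definition linear_comb c s t : seq (R * set S) := s ++ [seq (c * q.1, q.2) | q <- t].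

Lemma step_fun_linear_comb c s t p :
  step_fun (linear_comb c s t) p = step_fun s p + c * step_fun t p.
Proof.
rewrite /step_fun big_cat big_map mulr_sumr; congr (_ + _).
by apply: eq_bigr => q _; rewrite mulrA.
Qed.

Lemma noise_comb_linear_comb (Om : Type) (W : set S -> Om -> R) c s t w :
  noise_comb W (linear_comb c s t) w = noise_comb W s w + c * noise_comb W t w.
Proof.
rewrite /noise_comb big_cat big_map mulr_sumr; congr (_ + _).
by apply: eq_bigr => q _; rewrite mulrA.
Qed.

Lemma finite_sets_linear_comb c s t :
  finite_sets mu s -> finite_sets mu t -> finite_sets mu (linear_comb c s t).
Proof. by move=> hs ht q; rewrite mem_cat => /orP[/hs//|/mapP[r /ht rt ->]]. Qed.

Lemma finite_sets_cons q s :
  finite_sets mu (q :: s) -> [/\ measurable q.2, (mu q.2 < +oo)%E & finite_sets mu s].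
Proof.
move=> qs; have [mq fq] := qs q (mem_head _ _).
by split=> // r rs; apply: qs; rewrite inE rs orbT.
Qed.

Lemma step_fun_cons q s p : step_fun (q :: s) p = step_fun s p + q.1 * \1_(q.2) p.
Proof. by rewrite /step_fun big_cons addrC. Qed.

Lemma indic_Lfun2 (A : set S) : measurable A -> (mu A < +oo)%E ->
  (\1_A : S -> R) \in Lfun mu 2%:E.
Proof.
move=> mA fA; apply/Lfun2P; split; first exact: measurable_indic.
rewrite (eq_integral (fun x => (\1_A x : R)%:E)); first by rewrite integral_indic// setIT.
by move=> x _; rewrite indicE; case: (_ \in _); rewrite ?expr1n ?expr0n.
Qed.

Lemma step_fun_Lfun2 s : finite_sets mu s -> step_fun s \in Lfun mu 2%:E.
Proof.
elim: s => [_|q s ih /finite_sets_cons[mq fq hs]].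
  rewrite (_ : step_fun _ = \1_set0); first by rewrite indic_Lfun2 ?measure0 ?ltry.
  by apply/funext => p; rewrite /step_fun big_nil indic0.
rewrite (_ : step_fun _ = fun p => step_fun s p + q.1 * \1_(q.2) p).
  by apply: Lfun2_linear; [exact: ih|exact: indic_Lfun2].
by apply/funext => p; exact: step_fun_cons.
Qed.

Lemma L2dot_indic (A B : set S) : measurable A -> measurable B ->
  L2dot mu (\1_A) (\1_B) = fine (mu (A `&` B)).
Proof.
move=> mA mB; congr fine; rewrite -(setIT (A `&` B)) -integral_indic//; last exact: measurableI.
by apply: eq_integral => x _; rewrite indicI.
Qed.

Lemma L2dot_step_funl s f : finite_sets mu s -> f \in Lfun mu 2%:E ->
  L2dot mu (step_fun s) f = \sum_(q <- s) q.1 * L2dot mu (\1_(q.2)) f.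
Proof.
move=> + f2; elim: s => [_|q s ih /finite_sets_cons[mq fq hs]].
  rewrite big_nil /L2dot /Rintegral integral0_eq// => p _.
  by rewrite /step_fun big_nil mul0r.
rewrite big_cons addrC -ih// -L2dot_linearl//; [|exact: step_fun_Lfun2|exact: indic_Lfun2].
by congr L2dot; apply/funext => p; exact: step_fun_cons.
Qed.

Lemma L2dot_step_fun s t : finite_sets mu s -> finite_sets mu t ->
  L2dot mu (step_fun s) (step_fun t) =
  \sum_(q <- s) \sum_(q' <- t) q.1 * q'.1 * fine (mu (q.2 `&` q'.2)).
Proof.
move=> hs ht; rewrite L2dot_step_funl//; last exact: step_fun_Lfun2.
apply: eq_big_seq => q /hs[mq fq].
rewrite L2dotC L2dot_step_funl//; last exact: indic_Lfun2.
rewrite mulr_sumr; apply: eq_big_seq => q' /ht[mq' _].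
by rewrite L2dot_indic// setIC mulrA.
Qed.

Lemma nnsfun_step_fun (h : {nnsfun S >-> R}) : (h : S -> R) \in Lfun mu 2%:E ->
  exists2 s, finite_sets mu s & step_fun s = h.
Proof.
move=> /Lfun2P[mh h2]; pose A := range h `\ 0.
have finA : finite_set A by apply: finite_setD; exact: fimfunP.
exists [seq (r, h @^-1` [set r]) | r <- fset_set A].
  move=> q /mapP[r]; rewrite in_fset_set// => /set_mem [_ r0] ->/=; split=> //.
  have r_gt0 : 0 < `|r| by rewrite normr_gt0; apply/eqP.
  apply: (@le_lt_trans _ _ (mu [set w | (`|r| <= `|h w|)%R])).
    apply: le_measure; rewrite ?inE//; first exact: measurable_norm_ge.
    by move=> w /= ->.
  by apply: (le_lt_trans (chebyshev_sqr mu mh r_gt0)); exact: lte_mul_pinfty.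
apply/funext => p; rewrite /step_fun big_map/= -fsbig_finite// [in RHS]fimfunE.
rewrite (fsbig_widen A (range h))//; first by move=> x [].
by move=> r [rh /= /not_andP[//|/contrapT ->]] /=; rewrite mul0r.
Qed.

Lemma ge0_L2_step_dense f : (forall p, 0 <= f p) -> f \in Lfun mu 2%:E ->
  exists2 g, (forall n, finite_sets mu (g n)) & L2_cvg mu (fun n => step_fun (g n)) f.
Proof.
move=> f0 /[dup] f_L2 /Lfun2P[mf f2].
have mEf : measurable_fun setT (EFin \o f) by exact/measurable_EFinP.
have Ef0 x : setT x -> (0 <= (EFin \o f) x)%E by rewrite lee_fin.
pose a := nnsfun_approx measurableT mEf.
have af n x : 0 <= a n x <= f x.
  apply/andP; split=> //; rewrite -lee_fin /a nnsfun_approxE.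
  exact: (le_approx n Ef0).
have a2 n : (a n : S -> R) \in Lfun mu 2%:E.
  by apply: Lfun2_le f_L2 => // x; have /andP[? ?] := af n x; rewrite !ger0_norm.
have /choice[g gP] n : exists s, finite_sets mu s /\ step_fun s = a n.
  by have [s fs sE] := nnsfun_step_fun (a2 n); exists s.
exists g => [n|]; first by case: (gP n).
rewrite (_ : (fun n => _) = fun n => (a n : S -> R)); last by apply/funext => n; case: (gP n).
rewrite /L2_cvg; have [|||||_ _] := @dominated_convergence _ _ R mu setT measurableT
  (fun n p => ((a n p - f p) ^+ 2)%:E) (cst 0%E) (fun p => ((f p) ^+ 2)%:E).
- by move=> n; apply/measurable_EFinP/measurable_funX/measurable_funB.
- exact: measurable_cst.
- apply: aeW => p _.
  have ap : a n p @[n --> \oo] --> f p.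
    by have /fine_cvgP[] := cvg_nnsfun_approx measurableT mEf Ef0 (x := p) Logic.I.
  have diff0 : a n p - f p @[n --> \oo] --> (0 : R).
    by rewrite -[X in _ --> X](subrr (f p)); apply: cvgB => //; exact: cvg_cst.
  apply: cvg_EFin; first exact: nearW.
  by rewrite -[X in _ --> X](mulr0 0); exact: (cvgM diff0 diff0).
- exact: Lfun2_integrable_sqr f_L2.
- apply: aeW => p n _; rewrite gee0_abs ?lee_fin ?sqr_ge0//.
  by have /andP[? ?] := af n p; rewrite -sqrrN opprB lerXn2r ?nnegrE ?subr_ge0// gerBl.
by rewrite integral_cst// mul0e.
Qed.

Lemma L2_step_dense f : f \in Lfun mu 2%:E ->
  exists2 g, (forall n, finite_sets mu (g n)) & L2_cvg mu (fun n => step_fun (g n)) f.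
Proof.
move=> /[dup] f2 /Lfun2P[mf _].
have mpos : measurable_fun setT f^\+ by exact: measurable_funrpos.
have mneg : measurable_fun setT f^\- by exact: measurable_funrneg.
have [|g fg gf] := @ge0_L2_step_dense f^\+ (funrpos_ge0 f).
  apply: Lfun2_le f2 => // p; rewrite ger0_norm ?funrpos_ge0//.
  by rewrite /funrpos ge_max ler_norm normr_ge0.
have [|h fh hf] := @ge0_L2_step_dense f^\- (funrneg_ge0 f).
  apply: Lfun2_le f2 => // p; rewrite ger0_norm ?funrneg_ge0//.
  by rewrite /funrneg ge_max normr_ge0 -normrN ler_norm.
have mstep s : finite_sets mu s -> measurable_fun setT (step_fun s).
  by move=> /step_fun_Lfun2/Lfun2P[].
exists (fun n => linear_comb (-1) (g n) (h n)) => [n|]; first exact: finite_sets_linear_comb.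
have := L2_cvg_linear (-1) (fun n => mstep _ (fg n)) (fun n => mstep _ (fh n)) mpos mneg gf hf.
rewrite (_ : (fun x => _) = f); last first.
  by apply/funext => p; rewrite mulN1r -[in RHS](funrposBneg f).
by under eq_fun do under eq_fun do rewrite -step_fun_linear_comb.
Qed.

End step_functions.

Section wiener_integrals.
Context (R : realType) (d : measure_display) (Om : measurableType d)
  (Prob : probability Om R) (d' : measure_display) (S : measurableType d')
  (mu : {measure set S -> \bar R}) (W : set S -> Om -> R).
Hypothesis noiseW : gaussian_white_noise Prob mu W.
Implicit Types (f g : S -> R) (I J : Om -> R) (c : R).

(* Unlike [wiener_integral], which quantifies over all approximating step functions, this
   relation is visibly stable under linear combinations. *)
Definition noise_limit f I : Prop :=
  [/\ f \in Lfun mu 2%:E, measurable_fun setT I &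
      exists g : nat -> seq (R * set S),
      [/\ forall n, finite_sets mu (g n), L2_cvg mu (fun n => step_fun (g n)) f &
          L2_cvg Prob (fun n => noise_comb W (g n)) I]].

Lemma wiener_noise_limit f I : wiener_integral Prob mu W f I -> noise_limit f I.
Proof.
move=> [mf f2 mI limI]; have f_L2 : f \in Lfun mu 2%:E by exact/Lfun2P.
by split=> //; have [g fg gf] := L2_step_dense f_L2; exists g; split=> //; exact: limI.
Qed.

Lemma noise_limit0 : noise_limit (cst 0) (cst 0).
Proof.
split; [|exact: measurable_cst|exists (fun=> [::]); split=> //].
- apply/Lfun2P; split; first exact: measurable_cst.
  by under eq_integral do rewrite expr0n; rewrite integral0.
- rewrite /L2_cvg; under eq_fun do under eq_integral do
    rewrite /step_fun big_nil subrr expr0n.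
  by rewrite integral0; exact: cvg_cst.
- rewrite /L2_cvg; under eq_fun do under eq_integral do
    rewrite /noise_comb big_nil subrr expr0n.
  by rewrite integral0; exact: cvg_cst.
Qed.

Lemma noise_limit_linear f g I J c : noise_limit f I -> noise_limit g J ->
  noise_limit (fun p => f p + c * g p) (fun w => I w + c * J w).
Proof.
move=> [f2 mI [s [fs sf sI]]] [g2 mJ [t [ft tg tJ]]].
have mstep u : finite_sets mu u -> measurable_fun setT (step_fun u).
  by move=> /step_fun_Lfun2/Lfun2P[].
have mnoise u : finite_sets mu u -> measurable_fun setT (noise_comb W u) by case/noiseW.
have /Lfun2P[mf _] := f2; have /Lfun2P[mg _] := g2.
split; [exact: Lfun2_linear|by apply: measurable_funD => //; exact: measurable_funM|].
exists (fun n => linear_comb c (s n) (t n)); split.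
- by move=> n; exact: finite_sets_linear_comb.
- rewrite (_ : (fun n => _) = fun n p => step_fun (s n) p + c * step_fun (t n) p).
    by apply: L2_cvg_linear => // n; exact: mstep.
  by apply/funext => n; apply/funext => p; exact: step_fun_linear_comb.
- rewrite (_ : (fun n => _) = fun n w => noise_comb W (s n) w + c * noise_comb W (t n) w).
    by apply: L2_cvg_linear => // n; exact: mnoise.
  by apply/funext => n; apply/funext => w; exact: noise_comb_linear_comb.
Qed.

Lemma noise_limitB f g I J : noise_limit f I -> noise_limit g J ->
  noise_limit (fun p => f p - g p) (fun w => I w - J w).
Proof.
move=> fI gJ; have := noise_limit_linear (-1) fI gJ.
by under eq_fun do rewrite mulN1r; under [X in noise_limit _ X]eq_fun do rewrite mulN1r.
Qed.

Lemma noise_limit_sum (T : Type) (s : seq T) (c : T -> R) (f : T -> S -> R) (I : T -> Om -> R) :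
  (forall i, noise_limit (f i) (I i)) ->
  noise_limit (fun p => \sum_(i <- s) c i * f i p) (fun w => \sum_(i <- s) c i * I i w).
Proof.
move=> fI; elim: s => [|i s ih].
  rewrite (_ : (fun p => _) = cst 0); last by apply/funext => p; rewrite big_nil.
  rewrite (_ : (fun w => _) = cst 0); last by apply/funext => w; rewrite big_nil.
  exact: noise_limit0.
have := noise_limit_linear (c i) ih (fI i); congr noise_limit; apply/funext => p;
  by rewrite big_cons addrC.
Qed.

Lemma noise_limit_gaussian f I : noise_limit f I -> gaussian_rv Prob I 0 (L2dot mu f f).
Proof.
move=> [f2 mI [g [fg gf gI]]].
have /Lfun2P[mf _] := f2.
pose v n := L2dot mu (step_fun (g n)) (step_fun (g n)).
have v0 n : 0 <= v n by exact: L2dot_ge0.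
have g_gaussian n : gaussian_rv Prob (noise_comb W (g n)) 0 (v n).
  by rewrite /v L2dot_step_fun//; exact: noiseW.
suff -> : L2dot mu f f = L2dot Prob I I by exact: gaussian_rv_L2_cvg g_gaussian mI gI.
have g2 n : noise_comb W (g n) \in Lfun Prob 2%:E by exact: gaussian_rv_Lfun2 (g_gaussian n).
have cvg_v : v n @[n --> \oo] --> L2dot mu f f.
  by apply: L2_cvg_sqr => // n; exact: step_fun_Lfun2.
have := L2_cvg_sqr g2 mI gI; apply: cvg_unique => //.
apply: cvg_trans cvg_v; apply: near_eq_cvg; apply: nearW => n.
exact/esym/gaussian_rv_L2dot.
Qed.

Lemma noise_limit_Lfun2 f I : noise_limit f I -> I \in Lfun Prob 2%:E.
Proof. by move=> /noise_limit_gaussian; apply: gaussian_rv_Lfun2; exact: L2dot_ge0. Qed.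

Lemma noise_limit_centered f I : noise_limit f I -> (\int[Prob]_w (I w)%:E = 0)%E.
Proof. by move=> /noise_limit_gaussian; apply: gaussian_rv_mean; exact: L2dot_ge0. Qed.

Lemma noise_limit_isometry f g I J : noise_limit f I -> noise_limit g J ->
  L2dot Prob I J = L2dot mu f g.
Proof.
have isometry h K : noise_limit h K -> L2dot Prob K K = L2dot mu h h.
  by move=> /noise_limit_gaussian; apply: gaussian_rv_L2dot; exact: L2dot_ge0.
move=> fI gJ; have [f2 _ _] := fI; have [g2 _ _] := gJ.
have I2 := noise_limit_Lfun2 fI; have J2 := noise_limit_Lfun2 gJ.
have := isometry _ _ (noise_limitB fI gJ).
by rewrite !L2dotB_sqr// (isometry _ _ fI) (isometry _ _ gJ); lra.
Qed.

End wiener_integrals.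

(** * Poisson weights and their integrals against [ds / s] *)

Section poisson_weights.
Context {R : realType}.
Implicit Types (a c s t u x : R) (i k n : nat).

Lemma fact_neq0 n : n`!%:R != 0 :> R.
Proof. by rewrite pnatr_eq0 -lt0n fact_gt0. Qed.

Lemma psi0E t : psi 0 t = expR (- t).
Proof. by rewrite /psi expr0 fact0 divr1 mul1r. Qed.

Lemma psi_ge0 n t : 0 <= t -> 0 <= psi n t.
Proof. by move=> t0; rewrite /psi mulr_ge0 ?expR_ge0// divr_ge0 ?exprn_ge0. Qed.

Lemma psi_le1 n t : 0 <= t -> psi n t <= 1.
Proof.
move=> t0; rewrite /psi expRN ler_pdivrMr ?expR_gt0// mul1r.
case: n => [|n]; first by rewrite expr0 fact0 divr1 -expR0 ler_expR.
by rewrite (le_trans _ (expR_ge1Dxn n t0))// lerDr.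
Qed.

Lemma psi_at0 n : psi n (0 : R) = (n == 0%N)%:R.
Proof. by rewrite /psi expr0n oppr0 expR0 mulr1; case: n => [|n]; rewrite ?mul0r// fact0 divr1. Qed.

Lemma mul_psi n t : t * psi n t = n.+1%:R * psi n.+1 t.
Proof.
have := fact_neq0 n; have : n.+1%:R != 0 :> R by rewrite pnatr_eq0.
by rewrite /psi factS natrM exprS => ? ?; field; apply/andP.
Qed.

(* Superposition of two independent Poisson variables. *)
Lemma psi_mul i k a s : 1 + a != 0 ->
  psi i s * psi k (a * s) =
  'C(i + k, i)%:R * a ^+ k / (1 + a) ^+ (i + k) * psi (i + k) ((1 + a) * s).
Proof.
move=> a1; have fi := fact_neq0 i; have fk := fact_neq0 k; have fik := fact_neq0 (i + k).
have binE : 'C(i + k, i)%:R = (i + k)`!%:R / (i`!%:R * k`!%:R) :> R.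
  have := bin_fact (leq_addr k i); rewrite addKn => <-.
  by rewrite !natrM mulfK// mulf_neq0.
have expE : expR (- ((1 + a) * s)) = expR (- s) * expR (- (a * s)).
  by rewrite -expRD; congr expR; ring.
rewrite /psi binE expE !exprMn !exprD.
by field; rewrite fi fk fik !expf_neq0.
Qed.

Lemma cvg_psi_infty n (t : nat -> R) : t k @[k --> \oo] --> +oo ->
  psi n (t k) @[k --> \oo] --> (0 : R).
Proof.
move=> ty; apply: (@squeeze_cvgr _ _ _ _ (cst 0) (fun k => n.+1%:R * (t k)^-1)).
- near=> k; have t0 : 0 < t k by near: k; move/cvgryPgt: ty; apply.
  rewrite psi_ge0 ?(ltW t0)//= ler_pdivlMr// mulrC mul_psi.
  by rewrite ler_piMr// psi_le1// ltW.
- exact: cvg_cst.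
- rewrite -[X in _ --> X](mulr0 n.+1%:R); apply: cvgMl_tmp.
  by apply/gtr0_cvgV0 => //; near=> k; near: k; move/cvgryPgt: ty; apply.
Unshelve. all: by end_near. Qed.

Lemma is_derive_psi0 t : is_derive t (1 : R) (psi 0) (- psi 0 t).
Proof.
rewrite (_ : psi 0 = fun x => expR (- x)); last by apply/funext => x; rewrite psi0E.
by apply: is_derive_eq; rewrite /GRing.scale/= mulrN1.
Qed.

Lemma is_derive_psiS n t : is_derive t (1 : R) (psi n.+1) (psi n t - psi n.+1 t).
Proof.
have fn := fact_neq0 n; have n1 : n.+1%:R != 0 :> R by rewrite pnatr_eq0.
have dX : is_derive t (1 : R) (fun x => x ^+ n.+1) (n.+1%:R * t ^+ n).
  have := is_deriveX n.+1 (is_derive_id t (1 : R)); rewrite exprfctE => dX.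
  by apply: (is_derive_eq dX); rewrite /GRing.scale/= mulr1.
rewrite /psi; apply: is_derive_eq; rewrite /GRing.scale/= factS natrM exprS.
by field; rewrite fn addrC natr1 n1.
Qed.

Definition poisson_cdf n t : R := \sum_(k < n) psi k t.

Lemma poisson_cdf_ge0 n t : 0 <= t -> 0 <= poisson_cdf n t.
Proof. by move=> t0; apply: sumr_ge0 => i _; exact: psi_ge0. Qed.

Lemma poisson_cdf_at0 n : poisson_cdf n.+1 0 = 1.
Proof.
by rewrite /poisson_cdf big_ord_recl psi_at0 big1 ?addr0// => i _; rewrite psi_at0.
Qed.

Lemma is_derive_poisson_cdf n t : is_derive t (1 : R) (poisson_cdf n.+1) (- psi n t).
Proof.
elim: n => [|n ih].
  rewrite (_ : poisson_cdf 1 = psi 0); first exact: is_derive_psi0.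
  by apply/funext => x; rewrite /poisson_cdf big_ord1.
rewrite (_ : poisson_cdf n.+2 = poisson_cdf n.+1 \+ psi n.+1); last first.
  by apply/funext => x; rewrite /poisson_cdf big_ord_recr.
have dpsi := is_derive_psiS n t.
by apply: is_derive_eq; rewrite addrA addNr add0r.
Qed.

Lemma continuous_poisson_cdf n : continuous (poisson_cdf n).
Proof.
case: n => [|n] t; last exact: is_derive_continuous (is_derive_poisson_cdf n t).
rewrite (_ : poisson_cdf 0 = cst 0); first exact: cvg_cst.
by apply/funext => x; rewrite /poisson_cdf big_ord0.
Qed.

Lemma cvg_poisson_cdf_infty n (t : nat -> R) : t k @[k --> \oo] --> +oo ->
  poisson_cdf n (t k) @[k --> \oo] --> (0 : R).
Proof.
move=> ty; have -> : 0 = \sum_(i < n) 0 :> R by rewrite big1.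
by apply: cvg_big => [|i _]; [exact: add_continuous|exact: cvg_psi_infty].
Qed.

Lemma continuous_psi n : continuous (@psi R n).
Proof.
case: n => [|n] t; first exact: is_derive_continuous (is_derive_psi0 t).
exact: is_derive_continuous (is_derive_psiS n t).
Qed.

Lemma is_derive_scaled_exp c u x :
  is_derive x (1 : R) (fun x => c * expR (- (x - u))) (- (c * expR (- (x - u)))).
Proof. by apply: is_derive_eq; rewrite /GRing.scale/=; ring. Qed.

Lemma continuous_scaled_exp c u : continuous (fun x => c * expR (- (x - u))).
Proof. by move=> x; exact: is_derive_continuous (is_derive_scaled_exp c u x). Qed.

Lemma continuous_psi_scaled_exp n c u : continuous (fun x => psi n (c * expR (- (x - u)))).
Proof.
move=> x; apply: (cvg_comp (fun x => c * expR (- (x - u))) (psi n)).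
  exact: continuous_scaled_exp.
exact: continuous_psi.
Qed.

Lemma integral_psi_scaled_exp n c u : 0 < c ->
  (\int[lebesgue_measure]_x (psi n.+1 (c * expR (- (x - u))))%:E = (n.+1%:R^-1)%:E)%E.
Proof.
move=> c0; have n1 : n.+1%:R != 0 :> R by rewrite pnatr_eq0.
pose t x := c * expR (- (x - u)).
have t0 x : 0 <= t x by rewrite mulr_ge0 ?expR_ge0// ltW.
transitivity ((0 + (n.+1%:R^-1 * 1 - n.+1%:R^-1 * 0) : R)%:E); last first.
  by rewrite add0r mulr1 mulr0 subr0.
apply: (@ge0_integralT_is_derive _ _ (cst 0) (fun x => n.+1%:R^-1 * poisson_cdf n.+1 (t x))) => //.
- by move=> x; apply: psi_ge0; exact: t0.
- exact: continuous_psi_scaled_exp.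
- by move=> x; exact: cvg_cst.
- move=> x; have dF := is_derive1_comp (is_derive_poisson_cdf n (t x)) (is_derive_scaled_exp c u x).
  apply: (is_derive_eq (is_deriveZ n.+1%:R^-1 dF)).
  by rewrite /GRing.scale/= mulrNN subr0 -/(t x) [psi _ _ * _]mulrC mul_psi mulKf.
- apply: cvgMl_tmp; rewrite -[X in _ --> X](poisson_cdf_at0 n).
  have t_cvg0 : t k%:R @[k --> \oo] --> (0 : R).
    rewrite -[X in _ --> X](mulr0 c); apply: cvgMl_tmp.
    apply: (cvg_comp (fun k : nat => k%:R - u) (fun x => expR (- x))); last exact: cvgr_expR.
    exact: (cvg_comp _ _ cvgr_idn (cvg_addrr (- u))).
  by apply: (cvg_comp _ _ t_cvg0); exact: continuous_poisson_cdf.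
- apply: cvgMl_tmp; apply: cvg_poisson_cdf_infty; apply/cvgryPgt => A; near=> k.
  rewrite /t -ltr_pdivrMl// (lt_le_trans _ (expR_ge1Dx _))//.
  rewrite opprD !opprK -ltrBlDl -ltrBlDr; near: k; exact: nbhs_infty_gtr.
- by rewrite integral0.
Unshelve. all: by end_near. Qed.

End poisson_weights.

Section renormalized_integrals.
Context {R : realType}.
Local Notation mu := (@lebesgue_measure R).
Implicit Types (f g F G : R -> R) (a b c s u v w x : R) (i j k l m n : nat).

Definition has_integral f v : Prop :=
  mu.-integrable setT (EFin \o f) /\ (\int[mu]_x (f x)%:E = v%:E)%E.

Lemma ge0_has_integral f v : measurable_fun setT f -> (forall x, 0 <= f x) ->
  (\int[mu]_x (f x)%:E = v%:E)%E -> has_integral f v.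
Proof.
move=> mf f0 fv; split=> //; apply/integrableP; split; first exact/measurable_EFinP.
by under eq_integral do rewrite /= ger0_norm//; rewrite fv ltry.
Qed.

Lemma has_integral_cst0 : has_integral (cst 0) 0.
Proof. by split; [exact: integrable0|rewrite integral0]. Qed.

Lemma has_integralD f g v w : has_integral f v -> has_integral g w ->
  has_integral (fun x => f x + g x) (v + w).
Proof.
move=> [fi fv] [gi gw]; split; first exact: (integrableD measurableT fi gi).
by rewrite EFinD -fv -gw -integralD_EFin.
Qed.

Lemma has_integralZ c f v : has_integral f v -> has_integral (fun x => c * f x) (c * v).
Proof.
move=> [fi fv]; split; first exact: (integrableZl measurableT c fi).
by rewrite EFinM -fv -integralZl.
Qed.

Lemma has_integral_sum n (f : 'I_n -> R -> R) (v : 'I_n -> R) :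
  (forall i : 'I_n, has_integral (f i) (v i)) ->
  has_integral (fun x => \sum_(i < n) f i x) (\sum_(i < n) v i).
Proof.
elim: n f v => [|n ih] f v fv.
  rewrite big_ord0 (_ : (fun x => _) = cst 0); first exact: has_integral_cst0.
  by apply/funext => x; rewrite big_ord0.
rewrite big_ord_recl (_ : (fun x => _) = fun x => f ord0 x + \sum_(i < n) f (lift ord0 i) x).
  by apply: has_integralD => //; apply: ih.
by apply/funext => x; rewrite big_ord_recl.
Qed.

Lemma integral_indicM (D : set R) f :
  (\int[mu]_x (\1_D x * f x)%:E = \int[mu]_(x in D) (f x)%:E)%E.
Proof.
rewrite [RHS]integral_mkcond; apply: eq_integral => x _.
by rewrite patchE indicE; case: ifP => _; rewrite ?mul1r ?mul0r.
Qed.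

Lemma psi0B_integral a b s : 0 < s -> a <= b ->
  ((psi 0 (a * s) - psi 0 (b * s))%:E =
   \int[mu]_c (\1_`[a, b] c * (s * psi 0 (c * s)))%:E)%E.
Proof.
move=> s0 ab; rewrite integral_indicM.
have dF c : is_derive c (1 : R) (fun c => - psi 0 (c * s)) (s * psi 0 (c * s)).
  have dM : is_derive c (1 : R) (fun c => c * s) s.
    by apply: is_derive_eq; rewrite /GRing.scale/= mulr0 add0r mulr1.
  have dpsi := @is_derive1_comp _ (psi 0) (fun c => c * s) c _ _ (is_derive_psi0 (c * s)) dM.
  by apply: is_derive_eq; rewrite mulNr opprK mulrC.
have cf : continuous (fun c => s * psi 0 (c * s)).
  move=> c; apply: cvgMl_tmp; apply: (cvg_comp (fun c => c * s) (psi 0)).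
    by apply: cvgMr_tmp; exact: cvg_id.
  exact: continuous_psi.
rewrite (integral_itv_is_derive ab (fun c _ => dF c) (fun c _ => cf c)).
by rewrite opprK addrC.
Qed.

Lemma integral_inv_itv a b : 0 < a -> a <= b ->
  (\int[mu]_(c in `[a, b]) (c^-1)%:E = (ln (b / a))%:E)%E.
Proof.
move=> a0 ab; rewrite ln_div ?posrE ?(lt_le_trans a0 ab)//.
apply: integral_itv_is_derive => // c /andP[/(lt_le_trans a0) c0 _].
  exact: is_derive1_ln.
by apply: cvgV; rewrite ?gt_eqF//; exact: cvg_id.
Qed.

Lemma has_integral_frullani a b u : 0 < a -> a <= b ->
  has_integral (fun x => psi 0 (a * expR (- (x - u))) - psi 0 (b * expR (- (x - u)))) (ln (b / a)).
Proof.
move=> a0 ab; have mpsi n c : measurable_fun setT (fun x => psi n (c * expR (- (x - u)))).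
  by apply: continuous_measurable_fun; exact: continuous_psi_scaled_exp.
apply: ge0_has_integral; first exact: measurable_funB.
  by move=> x; rewrite subr_ge0 !psi0E ler_expR lerN2 ler_pM2r// expR_gt0.
under eq_integral do rewrite (psi0B_integral (expR_gt0 _) ab).
pose G (z : R * R) := (\1_`[a, b] z.2 * (expR (- (z.1 - u)) * psi 0 (z.2 * expR (- (z.1 - u)))))%:E.
have mG : measurable_fun setT G.
  have mexp : measurable_fun setT (fun z : R * R => expR (- (z.1 - u))).
    by apply: measurableT_comp => //; apply: measurable_funN; exact: measurable_funB.
  have mpsi0 : measurable_fun setT (@psi R 0).
    by apply: continuous_measurable_fun; exact: continuous_psi.
  apply/measurable_EFinP; apply: measurable_funM.
    by apply: measurableT_comp => //; exact: measurable_indic.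
  by apply: measurable_funM => //; apply: (measurableT_comp mpsi0); exact: measurable_funM.
have G0 z : (0 <= G z)%E by rewrite lee_fin !mulr_ge0// ?psi0E ?expR_ge0.
rewrite (@fubini_tonelli _ _ _ _ R mu mu G mG G0) -integral_inv_itv// -integral_indicM.
apply: eq_integral => c _; rewrite /G /= indicE; case: (boolP (c \in _)) => /= cab; last first.
  by under eq_integral do rewrite mul0r; rewrite integral0 mul0r.
have c0 : 0 < c by move: cab; rewrite inE/= in_itv/= => /andP[/(lt_le_trans a0)].
rewrite mul1r; transitivity (\int[mu]_x (c^-1%:E * (psi 1 (c * expR (- (x - u))))%:E))%E.
  apply: eq_integral => x _; rewrite -EFinM mul1r; congr EFin.
  have := mul_psi 0 (c * expR (- (x - u))); rewrite mul1r => <-.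
  by rewrite !mulrA mulVf ?mul1r// gt_eqF.
rewrite ge0_integralZl//.
- by rewrite integral_psi_scaled_exp// invr1 mule1.
- by apply/measurable_EFinP; exact: mpsi.
- by move=> x _; rewrite lee_fin psi_ge0// mulr_ge0 ?expR_ge0// ltW.
- by rewrite lee_fin invr_ge0 ltW.
Qed.

(* The value of [\int_0^oo (F s - w e^{-s}) ds / s], with [s = e^{-(x - u)}]. A combination of
   functions [s^k e^{-c s}] of total weight [w] at [s = 0] becomes integrable after subtracting
   [w e^{-s}]. *)
Definition renormalized_integral u F w v : Prop :=
  has_integral (fun x => F (expR (- (x - u))) - w * psi 0 (expR (- (x - u)))) v.

Lemma renormalized_integralZ c u F w v : renormalized_integral u F w v ->
  renormalized_integral u (fun s => c * F s) (c * w) (c * v).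
Proof. by move=> /(has_integralZ c); congr has_integral; apply/funext => x; ring. Qed.

Lemma renormalized_integral_sum u n (F : 'I_n -> R -> R) (w v : 'I_n -> R) :
  (forall i : 'I_n, renormalized_integral u (F i) (w i) (v i)) ->
  renormalized_integral u (fun s => \sum_(i < n) F i s) (\sum_(i < n) w i) (\sum_(i < n) v i).
Proof.
move=> /has_integral_sum; congr has_integral; apply/funext => x.
by rewrite mulr_suml -sumrB.
Qed.

Lemma renormalized_integralB u F G w v v' : renormalized_integral u F w v ->
  renormalized_integral u G w v' ->
  has_integral (fun x => F (expR (- (x - u))) - G (expR (- (x - u)))) (v - v').
Proof.
move=> hF /(has_integralZ (-1)) hG; have := has_integralD hF hG.
by rewrite mulN1r; congr has_integral; apply/funext => x; ring.
Qed.

Lemma renormalized_integral_psi u c j : 0 < c ->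
  renormalized_integral u (fun s => psi j (c * s)) (j == 0%N)%:R (j%:R^-1 - (j == 0%N)%:R * ln c).
Proof.
move=> c0; case: j => [|j].
  rewrite invr0 mul1r sub0r /renormalized_integral; have [c1|/ltW c1] := leP c 1.
    have := has_integral_frullani u c0 c1.
    by rewrite div1r lnV ?posrE//; congr has_integral; apply/funext => x; rewrite !mul1r.
  have := has_integralZ (-1) (has_integral_frullani u ltr01 c1).
  by rewrite mulN1r divr1; congr has_integral; apply/funext => x; rewrite !mul1r mulN1r opprB.
rewrite mul0r subr0 /renormalized_integral; under eq_fun do rewrite mul0r subr0.
apply: ge0_has_integral; last exact: integral_psi_scaled_exp.
  by apply: continuous_measurable_fun; exact: continuous_psi_scaled_exp.
by move=> x; rewrite psi_ge0// mulr_ge0 ?expR_ge0// ltW.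
Qed.

Definition pair_coef a i k : R := (i + k)%:R^-1 * ('C(i + k, i)%:R * a ^+ k / (1 + a) ^+ (i + k)).

Lemma renormalized_integral_psiM u a i k : 0 <= a ->
  renormalized_integral u (fun s => psi i s * psi k (a * s)) (i + k == 0)%N%:R
    (pair_coef a i k - (i + k == 0)%N%:R * ln (1 + a)).
Proof.
move=> a0; have a1 : 0 < 1 + a by rewrite (lt_le_trans ltr01)// lerDl.
pose b := 'C(i + k, i)%:R * a ^+ k / (1 + a) ^+ (i + k).
have b1 : b * (i + k == 0)%N%:R = (i + k == 0)%N%:R.
  rewrite {}/b; case: i k => [|i] [|k]; rewrite ?mulr0//.
  by rewrite bin0 !expr0 divr1 !mulr1.
have := renormalized_integralZ b (renormalized_integral_psi u (i + k) a1).
rewrite mulrBr mulrA b1 [b * _^-1]mulrC; congr renormalized_integral; apply/funext => s.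
by rewrite psi_mul// gt_eqF.
Qed.

Lemma renormalized_integral_psi_cdf u a l (m : nat -> nat) : 0 <= a -> (0 < m 0)%N ->
  renormalized_integral u (fun s => \sum_(i < l.+1) psi i s * poisson_cdf (m i) (a * s)) 1
    (\sum_(i < l.+1) \sum_(k < m i) pair_coef a i k - ln (1 + a)).
Proof.
move=> a0 m0; pose w := \sum_(i < l.+1) \sum_(k < m i) (i + k == 0)%N%:R : R.
have w1 : w = 1.
  rewrite /w big_ord_recl /= -(prednK m0) big_ord_recl /= !big1 ?addr0// => i _.
  by rewrite big1.
have := renormalized_integral_sum (fun i : 'I_l.+1 => renormalized_integral_sum
  (fun k : 'I_(m i) => renormalized_integral_psiM u i k a0)).
under [X in renormalized_integral _ _ _ X]eq_bigr => i _.
  rewrite sumrB -mulr_suml; over.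
rewrite sumrB -mulr_suml -/w w1 mul1r; congr renormalized_integral.
by apply/funext => s; apply: eq_bigr => i _; rewrite /poisson_cdf mulr_sumr.
Qed.

End renormalized_integrals.

(** * The covariance function *)

Section binomial_sums.
Variable R : comNzRingType.
Implicit Types (a p : R) (m n : nat).

Definition points_sum a p m n : R := \sum_(i < m) 'C(i + n, i)%:R * (p ^+ n.+1 * a ^+ i).

Lemma points_sumSS a p m n : a + p = 1 ->
  points_sum a p m.+1 n.+1 = a * points_sum a p m n.+1 + p * points_sum a p m.+1 n.
Proof.
move=> ap; rewrite /points_sum big_ord_recl [in p * _]big_ord_recl /= !bin0.
rewrite mulrDr addrA [a * _ + _]addrC -addrA; congr (_ + _); first by rewrite exprS; ring.
rewrite !mulr_sumr -big_split; apply: eq_bigr => i _ /=.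
by rewrite /bump /= add1n addSn binS natrD -addSnnS !exprS; ring.
Qed.

Lemma points_sum_0r a p m : a + p = 1 -> points_sum a p m 0 + a ^+ m = 1.
Proof.
move=> ap; elim: m => [|m ih]; first by rewrite /points_sum big_ord0 add0r expr0.
rewrite /points_sum big_ord_recr/= addn0 binn mul1r expr1 exprS.
by rewrite -addrA -mulrDl [p + a]addrC ap mul1r; exact: ih.
Qed.

(* The problem of points: in Bernoulli trials, either [n.+1] successes come before [m.+1]
   failures or conversely. *)
Lemma problem_of_points a p m n : a + p = 1 ->
  points_sum a p m.+1 n + points_sum p a n.+1 m = 1.
Proof.
move=> ap; have pa : p + a = 1 by rewrite addrC.
have single b q k : points_sum b q 1 k = q ^+ k.+1.
  by rewrite /points_sum big_ord1 bin0 mul1r expr0 mulr1.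
elim: m n => [|m ihm] n; first by rewrite single addrC points_sum_0r.
elim: n => [|n ihn]; first by rewrite single points_sum_0r.
rewrite points_sumSS// (points_sumSS _ _ pa).
transitivity (a * (points_sum a p m.+1 n.+1 + points_sum p a n.+2 m) +
    p * (points_sum a p m.+2 n + points_sum p a n.+1 m.+1)); first by ring.
by rewrite ihm ihn !mulr1.
Qed.

End binomial_sums.

Section pair_coefficients.
Variable R : realType.
Implicit Types (a : R) (i j k l : nat).

Lemma natrS_neq0 n : n.+1%:R != 0 :> R.
Proof. by rewrite pnatr_eq0. Qed.

Lemma pair_coefC a i k : 0 < a -> pair_coef a^-1 i k = pair_coef a k i.
Proof.
move=> a0; have a1 : 1 + a != 0 by rewrite gt_eqF// addr_gt0.
rewrite /pair_coef (addnC k i) -(bin_sub (leq_addr k i)) addKn; congr (_ * _).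
have -> : 1 + a^-1 = (1 + a) / a by field; rewrite gt_eqF.
by rewrite expr_div_n exprVn !exprD; field; rewrite !expf_neq0// gt_eqF.
Qed.

Lemma sum_pair_coef_edge a k : 0 < a ->
  \sum_(i < k.+1) (pair_coef a i k.+1 + pair_coef a k.+1 i) = k.+1%:R^-1.
Proof.
move=> a0; have a1 : 1 + a != 0 by rewrite gt_eqF// addr_gt0.
have p1 : (1 + a)^-1 + a / (1 + a) = 1 by rewrite -[X in X + _]mul1r -mulrDl mulfV.
have binE i : (i + k.+1)%:R^-1 * 'C(i + k.+1, i)%:R = k.+1%:R^-1 * 'C(i + k, i)%:R :> R.
  have ik0 : (i + k.+1)%:R != 0 :> R by rewrite addnS natrS_neq0.
  apply: (mulfI ik0); apply: (mulfI (natrS_neq0 k)).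
  rewrite mulVKf// mulrCA mulVKf ?natrS_neq0// -!natrM; congr (_%:R).
  rewrite -(bin_sub (leq_addr k.+1 i)) -(bin_sub (leq_addr k i)) !addKn.
  by rewrite addnS -mul_bin_diag.
rewrite -[RHS]mulr1 -[X in _ = _ * X](problem_of_points k k p1) /points_sum -big_split/= mulr_sumr.
apply: eq_bigr => i _; rewrite /pair_coef [(k.+1 + i)%N]addnC.
rewrite [X in _ + _ * (X%:R * _ / _)](_ : _ = 'C(i + k.+1, i)); last first.
  by rewrite -(bin_sub (leq_addr k.+1 i)) addKn.
rewrite !mulrA binE !expr_div_n !exprVn exprD; field.
by rewrite !expf_neq0//= addrC natr1 natrS_neq0.
Qed.

Lemma pair_coef_diag a k : 1 + a != 0 ->
  pair_coef a k k = (2 * k - 1)`!%:R * a ^+ k / (k`!%:R ^+ 2 * (1 + a) ^+ (2 * k)) - (k == 0%N)%:R.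
Proof.
move=> a1; case: k => [|k].
  by rewrite /pair_coef invr0 mul0r !expr0 fact0 expr1n mulr1 divr1 subrr.
rewrite subr0 /pair_coef addnn -mul2n.
have fk : (k.+1)`!%:R != 0 :> R by exact: fact_neq0.
have k20 : (2 * k.+1)%:R != 0 :> R by rewrite pnatr_eq0.
have binE : 'C(2 * k.+1, k.+1)%:R =
    (2 * k.+1)%:R * (2 * k.+1 - 1)`!%:R / ((k.+1)`!%:R ^+ 2) :> R.
  have := @bin_fact (2 * k.+1) k.+1; rewrite mul2n -addnn addnK leq_addr => /(_ isT).
  rewrite [X in _ = X -> _](_ : _ = ((k.+1 + k.+1) * (k.+1 + k.+1 - 1)`!)%N); last first.
    by rewrite addSn subn1 factS.
  move: (k.+1)`! (_ - 1)`! fk => f g f0 /(congr1 (fun n : nat => n%:R : R)).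
  by rewrite !natrM => <-; rewrite expr2 mulfK// mulf_neq0.
by rewrite binE -!mulrA mulKf//; field; rewrite fk expf_neq0.
Qed.

Lemma sum_pair_coef a l : 0 < a ->
  \sum_(i < l) \sum_(j < l) pair_coef a i j =
  \sum_(1 <= k < l) (k%:R^-1 + (2 * k - 1)`!%:R * a ^+ k / (k`!%:R ^+ 2 * (1 + a) ^+ (2 * k))).
Proof.
move=> a0; have a1 : 1 + a != 0 by rewrite gt_eqF// addr_gt0.
elim: l => [|l ih]; first by rewrite big_ord0 big_geq.
rewrite big_ord_recr/=; under eq_bigr do rewrite big_ord_recr/=.
rewrite big_split/= ih [X in _ + X = _]big_ord_recr/=.
case: l ih => [_|k _].
  by rewrite !big_ord0 !big_geq// !add0r /pair_coef invr0 !mul0r.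
rewrite [RHS]big_nat_recr//= -addrA; congr (_ + _).
by rewrite addrA -big_split/= sum_pair_coef_edge// pair_coef_diag// subr0.
Qed.

(* The binomial theorem; the junk value [0^-1 = 0] removes the column [j = 0]. *)
Lemma sum_pair_coef_column a j : 1 + a != 0 ->
  \sum_(i < j.+1) pair_coef a i (j - i) = j%:R^-1.
Proof.
move=> a1; transitivity
  (\sum_(i < j.+1) j%:R^-1 * (1 + a) ^- j * (a ^+ (j - i) * 1 ^+ i *+ 'C(j, i))).
  apply: eq_bigr => i _; rewrite /pair_coef subnKC ?expr1n ?mulr1; last by rewrite -ltnS.
  by rewrite -mulr_natr; ring.
by rewrite -mulr_sumr -exprDn (addrC a) -mulrA mulVf ?mulr1// expf_neq0.
Qed.

End pair_coefficients.

Section cross_covariance.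
Variable R : realType.
Implicit Types (u v : R) (i k l n : nat).

Lemma sum_shifted_columns (F : nat -> nat -> R) l n :
  \sum_(i < l) \sum_(k < l + n - i) F i k =
  \sum_(j < l) \sum_(i < j.+1) F i (j - i)%N + \sum_(r < n) \sum_(i < l) F i (l + r - i)%N.
Proof.
elim: n => [|n ih].
  rewrite big_ord0 addr0 addn0; elim: l => [|l ih]; first by rewrite !big_ord0.
  rewrite [RHS]big_ord_recr/= -ih.
  have -> : \sum_(i < l) \sum_(k < l - i) F i k = \sum_(i < l.+1) \sum_(k < l - i) F i k.
    by rewrite [RHS]big_ord_recr/= subnn big_ord0 addr0.
  by rewrite -big_split/=; apply: eq_bigr => i _; rewrite subSn ?big_ord_recr// -ltnS.
rewrite [in RHS]big_ord_recr/= addrA -ih -big_split/=; apply: eq_bigr => i _.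
by rewrite addnS subSn ?big_ord_recr// (leq_trans (ltnW (ltn_ord i)))// leq_addr.
Qed.

Lemma sum_columns_ge (F : nat -> nat -> R) l n :
  \sum_(i < l) \sum_(k < l + n) F i k =
  \sum_(i < l) \sum_(k < l) F i k + \sum_(r < n) \sum_(i < l) F i (l + r)%N.
Proof.
rewrite [X in _ = _ + X]exchange_big/= -big_split/=; apply: eq_bigr => i _.
by rewrite big_split_ord.
Qed.

Lemma sum_invn l : \sum_(j < l) (j%:R : R)^-1 = \sum_(1 <= j < l) j%:R^-1.
Proof.
case: l => [|l]; first by rewrite big_ord0 big_geq.
by rewrite -(big_mkord xpredT (fun j => (j%:R : R)^-1)) big_ltn// invr0 add0r.
Qed.

Lemma expR_ge1 u : (1 <= expR u) = (0 <= u).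
Proof. by rewrite -expR0 ler_expR. Qed.

Lemma expR_Ndist u v :
  expR (- `|u - v|) = expR (v - u) \/ expR (- `|u - v|) = (expR (v - u))^-1.
Proof.
rewrite -expRN; have [uv|/ltW uv] := leP 0 (u - v).
  by rewrite ger0_norm// opprB; left.
by rewrite ler0_norm// opprK opprB; right.
Qed.

Lemma cov_lE u v l : cov_l l u v =
  ln (1 + expR (- `|u - v|)) + \sum_(j < l) j%:R^-1 -
  \sum_(i < l) \sum_(k < l) pair_coef (expR (v - u)) i k.
Proof.
have -> : \sum_(i < l) \sum_(k < l) pair_coef (expR (v - u)) i k =
    \sum_(i < l) \sum_(k < l) pair_coef (expR (- `|u - v|)) i k.
  have [->//|->] := expR_Ndist u v; rewrite exchange_big/=.
  by under [RHS]eq_bigr do under eq_bigr do rewrite pair_coefC ?expR_gt0//.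
rewrite sum_pair_coef ?expR_gt0// big_split/= sum_invn opprD addrA addrK /cov_l.
by congr (_ - _); apply: eq_bigr => k _; rewrite expRM_natr.
Qed.

Lemma ln1D_expR_Ndist u v : ln (1 + expR (- `|u - v|)) =
  ln (1 + expR (v - u)) - ln (1 + Num.max (expR (v - u) - 1) 0).
Proof.
have [uv|/ltW vu] := leP u v.
  rewrite max_l ?subr_ge0 ?expR_ge1 ?subr_ge0// [X in _ - ln X]addrC subrK.
  rewrite ler0_norm ?subr_le0// -ln_div ?posrE ?addr_gt0 ?expR_gt0//; congr ln.
  by rewrite mulrDl mulfV ?gt_eqF ?expR_gt0// mul1r -expRN opprK opprB addrC.
rewrite max_r ?subr_le0 ?expR_le1 ?subr_le0// addr0 ln1 subr0.
by rewrite ger0_norm ?subr_ge0// opprB.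
Qed.

Lemma pair_coef_excess u v i k : pair_coef (Num.max (expR (v - u) - 1) 0) i k.+1 =
  (i + k.+1)%:R^-1 * 'C(i + k.+1, i)%:R *
  (Num.max (1 - expR (u - v)) 0) ^+ k.+1 * expR ((u - v) * i%:R).
Proof.
have [uv|/ltW vu] := leP u v; last first.
  rewrite !max_r ?subr_le0 ?expR_le1 ?expR_ge1 ?subr_le0 ?subr_ge0//.
  by rewrite /pair_coef !expr0n/= mulr0 !mul0r !mulr0 mul0r.
rewrite !max_l ?subr_ge0 ?expR_ge1 ?expR_le1 ?subr_ge0 ?subr_le0// /pair_coef.
rewrite [X in _ / X ^+ _]addrC subrK expRM_natr -(opprB v u) expRN.
have := expR_gt0 (v - u); move: (expR _) => c c0.
have c1 : c != 0 by rewrite gt_eqF.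
rewrite (_ : 1 - c^-1 = (c - 1) / c); last by field.
by rewrite exprMn !exprVn exprD invfM; ring.
Qed.

Lemma cross_covE u v l n : cross_cov l n u v =
  \sum_(i < l) \sum_(k < l + n - i) pair_coef (Num.max (expR (v - u) - 1) 0) i k
  - ln (1 + Num.max (expR (v - u) - 1) 0)
  - (\sum_(i < l) \sum_(k < l + n) pair_coef (expR (v - u)) i k - ln (1 + expR (v - u))).
Proof.
set a := Num.max _ _; set c := expR _.
have a1 : 1 + a != 0 by rewrite gt_eqF// (lt_le_trans ltr01)// lerDl le_max lexx orbT.
rewrite /cross_cov cov_lE ln1D_expR_Ndist -/c -/a sum_shifted_columns sum_columns_ge.
under [in RHS]eq_bigr do rewrite sum_pair_coef_column//.
have -> : \sum_(0 <= r < n) \sum_(0 <= i < l)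
    ((l + r)%:R^-1 * 'C(l + r, i)%:R * Num.max (1 - expR (u - v)) 0 ^+ (l + r - i)
      * expR ((u - v) * i%:R)
     - (l + r + i)%:R^-1 * 'C(l + r + i, i)%:R
      * expR ((u - v) * i%:R) / (1 + expR (u - v)) ^+ (l + r + i)) =
    \sum_(r < n) \sum_(i < l) pair_coef a i (l + r - i) -
    \sum_(r < n) \sum_(i < l) pair_coef c i (l + r).
  rewrite big_mkord -sumrB; apply: eq_bigr => r _.
  rewrite big_mkord -sumrB; apply: eq_bigr => i _; congr (_ - _).
    have il : (i < l + r)%N by rewrite (leq_trans (ltn_ord i))// leq_addr.
    by rewrite -(subnSK il) pair_coef_excess subnSK// subnKC// ltnW.
  rewrite -pair_coefC ?expR_gt0// /c -expRN opprB /pair_coef expRM_natr !mulrA.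
  by congr (_ * _%:R * _ / _); rewrite -(bin_sub (leq_addr i _)) addKn.
ring.
Qed.

(* [s] and [t] are the levels [- ln psi_0] of the two kernels at [x]. *)
Lemma has_integral_cross_cov u v l n :
  has_integral (fun x => let s := expR (- (x - u)) in let t := expR (- (x - v)) in
    \sum_(i < l.+1) psi i s * poisson_cdf (l.+1 + n - i) (Num.max (t - s) 0)
    - poisson_cdf l.+1 s * poisson_cdf (l.+1 + n) t)
  (cross_cov l.+1 n u v).
Proof.
pose c := expR (v - u); pose a := Num.max (c - 1) 0.
have a0 : 0 <= a by rewrite le_max lexx orbT.
have tE x : expR (- (x - v)) = c * expR (- (x - u)).
  by rewrite -expRD; congr expR; ring.
have excessE x : Num.max (expR (- (x - v)) - expR (- (x - u))) 0 = a * expR (- (x - u)).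
  by rewrite tE /a maxr_pMl ?expR_ge0// mulrBl mul1r mul0r.
have := renormalized_integralB
  (@renormalized_integral_psi_cdf _ u a l (fun i => l.+1 + n - i)%N a0 isT)
  (@renormalized_integral_psi_cdf _ u c l (fun=> l.+1 + n)%N (expR_ge0 _) isT).
rewrite cross_covE; congr has_integral; apply/funext => x /=.
by rewrite excessE tE -mulr_suml.
Qed.

End cross_covariance.

(** * Products of independent uniform variables *)

Section first_coordinate.
Variable R : realType.
Implicit Types (A : set (seqR R)) (f : seqR R) (i n : nat) (y : R).

Definition scons (z : measurableTypeR R * seqR R) : seqR R :=
  fun i => if i is k.+1 then z.2 k else z.1.

Definition cylinder n (B : nat -> set R) : set (seqR R) :=
  [set f : seqR R | forall i, (i < n)%N -> B i (f i)].

Definition tail_section A y : set (seqR R) := [set f | A (scons (y, f))].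

Lemma measurable_coord i : measurable_fun setT (fun f : seqR R => f i).
Proof. by move=> _ B mB; rewrite setTI; apply: sub_sigma_algebra; exists i, B. Qed.

Lemma measurable_scons : measurable_fun setT scons.
Proof.
apply: (@measurability _ _ _ (seqR R) setT scons (@coord_sets R) erefl).
move=> _ [_ [i [B [mB ->]]] <-]; rewrite setTI; case: i => [|k].
  exact: (measurable_preimage (f := fst)).
apply: measurable_preimage mB; exact: (measurableT_comp (measurable_coord k)).
Qed.

Lemma tail_sectionE A y : tail_section A y = xsection (scons @^-1` A) y.
Proof. by apply/seteqP; split => f; rewrite xsectionE. Qed.

Lemma measurable_tail_section A y : measurable A -> measurable (tail_section A y).
Proof.
move=> mA; rewrite tail_sectionE; apply: measurable_xsection.
exact: measurable_preimage measurable_scons mA.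
Qed.

Lemma measurable_cylinder n (B : nat -> set R) :
  (forall i, measurable (B i)) -> measurable (cylinder n B).
Proof.
move=> mB; rewrite (_ : cylinder n B =
    \bigcap_(i in [set i | (i < n)%N]) ((fun f : seqR R => f i) @^-1` (B i))).
  by apply: bigcap_measurableType => i _; apply: measurable_preimage => //; exact: measurable_coord.
by apply/seteqP; split => f /= h i; exact: h.
Qed.

Lemma preimage_scons_cylinder n (B : nat -> set R) :
  scons @^-1` cylinder n.+1 B = B 0%N `*` cylinder n (fun i => B i.+1).
Proof.
apply/seteqP; split => [[y f] h|[y f] [h0 h] [|i] lt //]; last exact: h.
by split=> [|i lt]; [exact: (h 0%N)|exact: (h i.+1)].
Qed.

Lemma uniform_prob01 (B : set R) : measurable B ->
  uniform_prob (@ltr01 R) B = lebesgue_measure (B `&` `[0%R, 1%R]).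
Proof.
move=> mB; rewrite /uniform_prob integral_uniform_pdf (eq_integral (cst 1%E)).
  by rewrite integral_cst ?mul1e//; exact: measurableI.
move=> x; rewrite inE => -[_ /=]; rewrite in_itv/= /uniform_pdf => ->.
by rewrite subr0 invr1.
Qed.

Lemma eq_measure_cylinder (m1 m2 : {measure set (seqR R) -> \bar R}) :
  (m1 setT < +oo)%E ->
  (forall n B, (forall i, measurable (B i)) -> m1 (cylinder n B) = m2 (cylinder n B)) ->
  forall A, measurable A -> m1 A = m2 A.
Proof.
move=> fin m12 A mA.
pose G : set (set (seqR R)) :=
  [set C | exists n B, (forall i, measurable (B i)) /\ C = cylinder n B].
apply: (@g_sigma_algebra_measure_unique _ R (seqR R) G _ (fun=> setT)).
- by move=> _ [n [B [mB ->]]]; exact: measurable_cylinder.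
- by move=> _; exists 0%N, (fun=> setT); split=> //; apply/seteqP; split.
- by apply/seteqP; split => // x _; exists 0%N.
- move=> _ _ [n [B [mB ->]]] [n' [B' [mB' ->]]]; exists (maxn n n'), (fun i =>
    (if (i < n)%N then B i else setT) `&` (if (i < n')%N then B' i else setT)).
  split; first by move=> i; apply: measurableI; case: ifP.
  apply/seteqP; split => f.
    by move=> [h h'] i _; split; case: ifP => // ?; [exact: h|exact: h'].
  by move=> h; split => i lt; have [] := h i (leq_trans lt _); rewrite ?leq_maxl ?leq_maxr// lt.
- by move=> _ [n [B [mB ->]]]; exact: m12.
- by [].
apply: (smallest_sub _ _ mA); first exact: smallest_sigma_algebra.
move=> _ [i [B [mB ->]]]; apply: sub_sigma_algebra.
exists i.+1, (fun j => if j == i then B else setT); split; first by move=> j; case: ifP.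
apply/seteqP; split => f /=; last by move=> /(_ i (ltnSn i)); rewrite eqxx.
by move=> Bf j _; case: eqP => [->|].
Qed.

Variable P : probability (seqR R) R.

Lemma measurable_prob_tail_section A : measurable A ->
  measurable_fun setT (fun y => P (tail_section A y)).
Proof.
move=> mA; under eq_fun do rewrite tail_sectionE.
by apply: measurable_fun_xsection; exact: measurable_preimage measurable_scons mA.
Qed.

Hypothesis iidP : iid_uniform P.

Lemma iid_uniform_cylinder n (B : nat -> set R) : (forall i, measurable (B i)) ->
  (P (cylinder n B) = \prod_(i < n) lebesgue_measure (B i `&` `[0%R, 1%R]))%E.
Proof. exact: iidP. Qed.

Lemma iid_uniform_scons_cylinder n (B : nat -> set R) : (forall i, measurable (B i)) ->
  (uniform_prob (@ltr01 R) \x P)%E (scons @^-1` cylinder n B) = P (cylinder n B).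
Proof.
move=> mB; rewrite iid_uniform_cylinder//; case: n => [|n].
  rewrite big_ord0 (_ : _ @^-1` _ = setT `*` setT); last by apply/seteqP; split.
  rewrite product_measure1E// -[RHS](mule1 1%E).
  by congr (_ * _)%E; exact: probability_setT.
rewrite preimage_scons_cylinder product_measure1E; last 2 first.
- exact: mB.
- exact: measurable_cylinder.
rewrite big_ord_recl; congr (_ * _)%E; first exact: uniform_prob01.
exact: iid_uniform_cylinder.
Qed.

Lemma iid_uniform_first_coord A : measurable A ->
  (P A = \int[lebesgue_measure]_(y in `[0%R, 1%R]) P (tail_section A y))%E.
Proof.
move=> mA.
pose S : {mfun (measurableTypeR R * seqR R)%type >-> seqR R} :=
  HB.pack scons (isMeasurableFun.Build _ _ _ _ scons measurable_scons).
have -> : P A = pushforward (uniform_prob (@ltr01 R) \x P)%E S A.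
  apply: eq_measure_cylinder => // [|n B mB].
    by rewrite -ge0_fin_numE//; exact: fin_num_measure.
  by apply/esym; exact: iid_uniform_scons_cylinder.
rewrite -[LHS]/(\int[uniform_prob (@ltr01 R)]_x (P \o xsection (scons @^-1` A)) x)%E.
have mSA : measurable (scons @^-1` A) by exact: measurable_preimage measurable_scons mA.
rewrite integral_uniform//; last exact: measurable_fun_xsection.
by rewrite subr0 invr1 mul1e; apply: eq_integral => y _; rewrite tail_sectionE.
Qed.

Lemma iid_uniform_ae_itv : \forall f \ae P, forall i, 0 <= f i <= 1.
Proof.
apply/ae_foralln => i; pose U := cylinder i.+1 (fun=> `[0, 1]%classic).
have mU : measurable U by exact: measurable_cylinder.
exists (~` U); split=> [||f /= fi Uf].
- exact: measurableC.
- rewrite [LHS](probability_setC P mU) iid_uniform_cylinder// big1 ?subee// => k _.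
  by rewrite setIid lebesgue_measure_itv/= lte01 oppr0 adde0.
- by case: fi; have := Uf i (ltnSn i); rewrite /= in_itv.
Qed.

End first_coordinate.

Section log_integrals.
Variable R : realType.
Local Notation mu := (@lebesgue_measure R).
Implicit Types (a b s t y : R) (i l m : nat).

Lemma is_derive_mul_comp_ln (G : R -> R) g t y : 0 < y ->
  is_derive (t + ln y) (1 : R) G g ->
  is_derive y (1 : R) (fun y => y * G (t + ln y)) (G (t + ln y) + g).
Proof.
move=> y0 dG; have dln : is_derive y (1 : R) (fun y => t + ln y) y^-1.
  by have := is_deriveD (is_derive_cst t y (1 : R)) (is_derive1_ln y0); rewrite add0r.
have := is_deriveM (is_derive_id y (1 : R)) (@is_derive1_comp _ G _ y _ _ dG dln).
rewrite mulrfctE => dM; apply: (is_derive_eq dM).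
by rewrite /GRing.scale/= mulr1 addrC mulrCA mulfV ?mulr1// gt_eqF.
Qed.

Lemma continuous_comp_ln (G : R -> R) t y : 0 < y -> continuous G ->
  {for y, continuous (fun y => G (t + ln y))}.
Proof.
move=> y0 cG; apply: (cvg_comp (fun y => t + ln y) G); last exact: cG.
by apply: cvgD; [exact: cvg_cst|exact: continuous_ln].
Qed.

Lemma integral_poisson_cdf_ln m s t : s <= t ->
  (\int[mu]_(y in `[expR (- t), expR (- s)]) (poisson_cdf m (t + ln y))%:E =
   (expR (- s) * poisson_cdf m.+1 (t - s) - expR (- t))%:E)%E.
Proof.
move=> st; have y_gt0 y : expR (- t) <= y <= expR (- s) -> 0 < y.
  by move=> /andP[/(lt_le_trans (expR_gt0 _))].
pose F y := y * poisson_cdf m.+1 (t + ln y).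
transitivity ((F (expR (- s)) - F (expR (- t)))%:E); last first.
  by rewrite /F !expRK subrr poisson_cdf_at0 mulr1.
apply: integral_itv_is_derive => [|y /y_gt0 y0|y /y_gt0 y0].
- by rewrite ler_expR lerN2.
- have := is_derive_mul_comp_ln y0 (is_derive_poisson_cdf m (t + ln y)).
  by rewrite [X in X - _]/poisson_cdf big_ord_recr/= addrK.
- by apply: continuous_comp_ln => //; exact: continuous_poisson_cdf.
Qed.

Lemma integral_psi_ln i s : 0 <= s ->
  (\int[mu]_(y in `[expR (- s), 1%R]) (psi i (s + ln y))%:E = (psi i.+1 s)%:E)%E.
Proof.
move=> s0; have y_gt0 y : expR (- s) <= y <= 1 -> 0 < y.
  by move=> /andP[/(lt_le_trans (expR_gt0 _))].
pose F y := y * psi i.+1 (s + ln y).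
transitivity ((F 1 - F (expR (- s)))%:E); last first.
  by rewrite /F ln1 addr0 mul1r expRK subrr psi_at0 mulr0 subr0.
apply: integral_itv_is_derive => [|y /y_gt0 y0|y /y_gt0 y0].
- by rewrite expR_le1 oppr_le0.
- have := is_derive_mul_comp_ln y0 (is_derive_psiS i (s + ln y)).
  by rewrite addrC subrK.
- by apply: continuous_comp_ln => //; exact: continuous_psi.
Qed.

Lemma ge0_integral_itv_split (g : R -> \bar R) a b (c : R) : a <= b -> b <= c ->
  measurable_fun setT g -> (forall y, 0 <= g y)%E ->
  (\int[mu]_(y in `[a, c]) g y = \int[mu]_(y in `[a, b[) g y + \int[mu]_(y in `[b, c]) g y)%E.
Proof.
move=> ab bc mg g0.
rewrite (_ : `[a, c]%classic = `[a, b[%classic `|` `[b, c]%classic); last first.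
  by rewrite -itv_bndbnd_setU// bnd_simp.
rewrite ge0_integral_setU//; first exact: measurable_funTS.
apply/disj_setPS => y []; rewrite /= !in_itv/= => /andP[_ yb] /andP[by_ _].
by have := lt_le_trans yb by_; rewrite ltxx.
Qed.

Lemma integral_sum_psi_ln l s (c : nat -> R) : 0 <= s -> (forall i, 0 <= c i) ->
  (\int[mu]_(y in `[expR (- s), 1%R]) (\sum_(i < l) psi i (s + ln y) * c i)%:E =
   (\sum_(i < l) psi i.+1 s * c i)%:E)%E.
Proof.
move=> s0 c0; rewrite -sumEFin; under eq_integral do rewrite -sumEFin.
have mpsi i : measurable_fun setT (fun y => (psi i (s + ln y))%:E).
  apply/measurable_EFinP; apply: (measurableT_comp (f := psi i)).
    by apply: continuous_measurable_fun; exact: continuous_psi.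
  by apply: measurable_funD => //; exact: measurable_ln.
have psi0 i y : y \in `[expR (- s), 1%R]%classic -> (0 <= (psi i (s + ln y))%:E)%E.
  rewrite inE/= in_itv/= => /andP[sy _]; have y0 := lt_le_trans (expR_gt0 (- s)) sy.
  by rewrite lee_fin psi_ge0// -lerBlDl sub0r -ler_expR lnK ?posrE.
rewrite ge0_integral_sum//.
- apply: eq_bigr => i _; rewrite EFinM -integral_psi_ln//; under eq_integral do rewrite EFinM.
  rewrite ge0_integralZr// ?lee_fin//; first by apply: measurable_funTS; exact: mpsi.
  by move=> y /mem_set/psi0.
- move=> i; apply/measurable_EFinP; apply: measurable_funM => //.
  by apply/measurable_EFinP; apply: measurable_funTS; exact: mpsi.
- by move=> i y /mem_set/(psi0 i) psi_ge; rewrite EFinM mule_ge0// lee_fin.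
Qed.

End log_integrals.

Section product_law.
Context {R : realType}.
Local Notation mu := (@lebesgue_measure R).
Implicit Types (f : seqR R) (k l m n : nat) (s t y : R).

Definition sprod n f : R := \prod_(i < n) f i.

Definition sprod_below n t : set (seqR R) := [set f | sprod n f < expR (- t)].

Lemma sprod_scons n y f : sprod n.+1 (scons (y, f)) = y * sprod n f.
Proof. by rewrite /sprod big_ord_recl. Qed.

Lemma measurable_sprod n : measurable_fun setT (sprod n).
Proof.
elim: n => [|n ih].
  by rewrite (_ : sprod 0 = cst 1)//; apply/funext => f; rewrite /sprod big_ord0.
rewrite (_ : sprod n.+1 = fun f => sprod n f * f n).
  by apply: measurable_funM => //; exact: measurable_coord.
by apply/funext => f; rewrite /sprod big_ord_recr.
Qed.

Lemma measurable_sprod_below n t : measurable (sprod_below n t).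
Proof.
rewrite (_ : sprod_below n t = sprod n @^-1` `]-oo, expR (- t)[%classic).
  by apply: measurable_preimage => //; exact: measurable_sprod.
by apply/seteqP; split => f /=; rewrite in_itv.
Qed.

Lemma sprod_ge0 n f : (forall i, 0 <= f i <= 1) -> 0 <= sprod n f.
Proof. by move=> f01; apply: prodr_ge0 => i _; have /andP[] := f01 i. Qed.

Lemma ler_sprod m n f : (forall i, 0 <= f i <= 1) -> (m <= n)%N -> sprod n f <= sprod m f.
Proof.
move=> f01 /subnK <-; elim: (n - m)%N => [//|k]; apply: le_trans.
by rewrite addSn /sprod big_ord_recr/= ler_piMr ?sprod_ge0//; have /andP[] := f01 (k + m)%N.
Qed.

Lemma sprod_below0 t : 0 <= t -> sprod_below 0 t = set0.
Proof.
move=> t0; apply/seteqP; split => // f; rewrite /sprod_below /= /sprod big_ord0.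
by rewrite ltNge expR_le1 oppr_le0 t0.
Qed.

Lemma tail_section_sprod_below n t y : 0 < y ->
  tail_section (sprod_below n.+1 t) y = sprod_below n (t + ln y).
Proof.
move=> y0; apply/seteqP; split => f; rewrite /tail_section /sprod_below /= sprod_scons;
  by rewrite opprD expRD (expRN (ln y)) lnK ?posrE// ltr_pdivlMr// mulrC.
Qed.

Variable P : probability (seqR R) R.
Hypothesis iidP : iid_uniform P.

Lemma eq_prob_itv01 (A B : set (seqR R)) : measurable A -> measurable B ->
  (forall f, (forall i, 0 <= f i <= 1) -> (A f <-> B f)) -> P A = P B.
Proof.
move=> mA mB AB; rewrite -[A]setIT -[B]setIT -!integral_indic//.
apply: ae_eq_integral => //; [exact/measurable_EFinP/measurable_indic..|].
move: (iid_uniform_ae_itv iidP); apply: filterS; first exact: (ae_filter_ringOfSetsType P).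
move=> f /AB {}AB _; congr EFin; rewrite !indicE.
by rewrite (_ : (f \in A) = (f \in B))//; apply/idP/idP => /set_mem/AB/mem_set.
Qed.

Lemma integral_tail_sprod_below m s t :
  (forall r, 0 <= r -> P (sprod_below m r) = (poisson_cdf m r)%:E) -> 0 <= s -> s <= t ->
  (\int[mu]_(y in `[0%R, expR (- s)[) P (tail_section (sprod_below m.+1 t) y) =
   (expR (- s) * poisson_cdf m.+1 (t - s))%:E)%E.
Proof.
move=> cdf s0 st; have mB := measurable_sprod_below m.+1 t.
have mPB := measurable_prob_tail_section P mB.
rewrite integral_itv_bndo_bndc; last exact: measurable_funTS.
rewrite (@ge0_integral_itv_split _ _ _ (expR (- t)))// ?ler_expR ?lerN2//.
have -> : (\int[mu]_(y in `[0%R, expR (- t)[) P (tail_section (sprod_below m.+1 t) y) =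
    (expR (- t))%:E)%E.
  transitivity (\int[mu]_(y in `[0%R, expR (- t)[) cst 1%E y)%E; last first.
    by rewrite integral_cst//= lebesgue_measure_itv/= lte_fin expR_gt0 oppr0 adde0 mul1e.
  apply: eq_integral => y; rewrite inE/= in_itv/= => /andP[y0 yt].
  rewrite -(probability_setT P); apply: eq_prob_itv01 => // [|f f01].
    exact: measurable_tail_section.
  split=> // _; rewrite /tail_section /sprod_below /= sprod_scons (le_lt_trans _ yt)//.
  by rewrite ler_piMr// (le_trans (ler_sprod f01 (leq0n m)))// /sprod big_ord0.
rewrite -[X in _ = X%:E](subrKC (expR (- t))) EFinD.
congr (_ + _)%E; rewrite -integral_poisson_cdf_ln//; apply: eq_integral => y.
rewrite inE/= in_itv/= => /andP[ty ys]; have y0 := lt_le_trans (expR_gt0 (- t)) ty.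
by rewrite tail_section_sprod_below// cdf// -lerBlDl sub0r -ler_expR lnK ?posrE.
Qed.

Lemma prob_sprod_below m t : 0 <= t -> P (sprod_below m t) = (poisson_cdf m t)%:E.
Proof.
elim: m t => [|m ih] t t0; first by rewrite sprod_below0// measure0 /poisson_cdf big_ord0.
have mB := measurable_sprod_below m.+1 t.
rewrite (iid_uniform_first_coord iidP)// -integral_itv_bndo_bndc; last first.
  by apply: measurable_funTS; exact: measurable_prob_tail_section.
have := integral_tail_sprod_below ih (lexx 0) t0.
by rewrite oppr0 expR0 addr0 mul1r; exact.
Qed.

Lemma prob_sprod_belowI_le l m s t : (l <= m)%N -> 0 <= s -> s <= t ->
  (P (sprod_below l s `&` sprod_below m t) =
   (\sum_(i < l) psi i s * poisson_cdf (m - i) (t - s))%:E)%E.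
Proof.
elim: l m s t => [|l ih] m s t lm s0 st.
  by rewrite big_ord0 sprod_below0// set0I measure0.
case: m lm => [//|m] lm.
have mA := measurable_sprod_below l.+1 s; have mB := measurable_sprod_below m.+1 t.
have mAB : measurable (sprod_below l.+1 s `&` sprod_below m.+1 t) by exact: measurableI.
rewrite (iid_uniform_first_coord iidP)// (@ge0_integral_itv_split _ _ _ (expR (- s)))//.
- rewrite big_ord_recl subn0 EFinD psi0E; congr (_ + _)%E.
    rewrite -(integral_tail_sprod_below (@prob_sprod_below m))//; apply: eq_integral => y.
    rewrite inE/= in_itv/= => /andP[y0 ys].
    apply: eq_prob_itv01 => [||f f01]; [exact: measurable_tail_section..|].
    split=> [[]//|tB]; split=> //; rewrite /tail_section /sprod_below /= sprod_scons.
    rewrite (le_lt_trans _ ys)// ler_piMr// (le_trans (ler_sprod f01 (leq0n l)))//.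
    by rewrite /sprod big_ord0.
  rewrite (_ : \sum_(i < l) _ = \sum_(i < l) psi i.+1 s * poisson_cdf (m - i) (t - s))//.
  rewrite -(integral_sum_psi_ln _ (c := fun i => poisson_cdf (m - i) (t - s)))//; last first.
    by move=> i; apply: poisson_cdf_ge0; rewrite subr_ge0.
  apply: eq_integral => y.
  rewrite inE/= in_itv/= => /andP[sy y1]; have y0 := lt_le_trans (expR_gt0 (- s)) sy.
  have sy0 : 0 <= s + ln y by rewrite -lerBlDl sub0r -ler_expR lnK ?posrE.
  rewrite [tail_section _ _](_ : _ = sprod_below l (s + ln y) `&` sprod_below m (t + ln y)).
    by rewrite ih ?lerD2r// opprD addrACA subrr addr0.
  by rewrite -!tail_section_sprod_below.
- by rewrite expR_le1 oppr_le0.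
- exact: measurable_prob_tail_section.
Qed.

Lemma prob_sprod_belowI l m s t : (l <= m)%N -> 0 <= s -> 0 <= t ->
  (P (sprod_below l s `&` sprod_below m t) =
   (\sum_(i < l) psi i s * poisson_cdf (m - i) (Num.max (t - s) 0))%:E)%E.
Proof.
move=> lm s0 t0; have [st|/ltW ts] := leP s t.
  by rewrite max_l ?subr_ge0// prob_sprod_belowI_le.
rewrite max_r ?subr_le0// (@eq_prob_itv01 _ (sprod_below l s)).
- rewrite prob_sprod_below//; congr EFin; apply: eq_bigr => i _.
  by rewrite -(subnSK (leq_trans (ltn_ord i) lm)) poisson_cdf_at0 mulr1.
- by apply: measurableI; exact: measurable_sprod_below.
- exact: measurable_sprod_below.
- move=> f f01; split=> [[]//|fs]; split=> //; rewrite /sprod_below /=.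
  by rewrite (le_lt_trans (ler_sprod f01 lm))// (lt_le_trans fs)// ler_expR lerN2.
Qed.

Lemma prob_sprod_eq k t : 0 < t -> P [set f | sprod k.+1 f = expR (- t)] = 0%E.
Proof.
move=> t0; set E := [set f | _].
have mE : measurable E.
  exact: measurable_preimage (measurable_sprod k.+1) (measurable_set1 (expR (- t))).
have bound u : 0 <= u -> u < t -> (P E <= (poisson_cdf k.+1 u - poisson_cdf k.+1 t)%:E)%E.
  move=> u0 ut; have mS r := measurable_sprod_below k.+1 r.
  rewrite EFinB leeBrDr// -!prob_sprod_below ?(ltW t0)// -measureU//; last first.
    by apply/seteqP; split => // f []; rewrite /E /sprod_below /= => ->; rewrite ltxx.
  apply: le_measure; rewrite ?inE//; first exact: measurableU.
  have tu : expR (- t) < expR (- u) by rewrite ltr_expR ltrN2.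
  by move=> f [Ef|ft]; rewrite /sprod_below /=; [rewrite Ef|exact: lt_trans ft tu].
apply/eqP; rewrite eq_le measure_ge0 andbT; apply/lee_addgt0Pr => e e0; rewrite add0e.
have : \forall u \near t^'-, `|poisson_cdf k.+1 t - poisson_cdf k.+1 u| < e.
  apply: cvgr_dist_lt => //; apply: cvg_at_left_filter; exact: continuous_poisson_cdf.
move=> cdf_near; near t^'- => u.
apply: (le_trans (bound u _ _)).
- by near: u; exact: nbhs_left_ge.
- by near: u; exact: nbhs_left_lt.
- by rewrite lee_fin (le_trans (ler_norm _))// distrC ltW//; near: u.
Unshelve. all: by end_near. Qed.

End product_law.

(** * The covariance of the process *)

Section covariance_of_indicators.
Context {R : realType} {d : measure_display} {T : measurableType d}.
Variable P : probability T R.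
Implicit Types (A B : set T).

Lemma covariance_indic A B : measurable A -> measurable B ->
  covariance P \1_A \1_B = (P (A `&` B) - P A * P B)%E.
Proof.
move=> mA mB; have L1 C : measurable C -> (\1_C : T -> R) \in Lfun P 1.
  by move=> mC; apply/Lfun1_integrable; exact: integrable_indic.
have mulE : (\1_A * \1_B)%R = \1_(A `&` B) :> (T -> R) by rewrite indicI.
have mAB := measurableI _ _ mA mB.
by rewrite covarianceE ?mulE ?L1//; rewrite !expectation_indic.
Qed.

Lemma integral_centered_indic A B a b : measurable A -> measurable B ->
  P A = a%:E -> P B = b%:E ->
  (\int[P]_y ((a - \1_A y) * (b - \1_B y))%:E = P (A `&` B) - (a * b)%:E)%E.
Proof.
move=> mA mB PA PB; rewrite EFinM -PA -PB -covariance_indic// covariance.unlock.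
rewrite !expectation_indic// PA PB expectation.unlock; apply: eq_integral => y _.
congr EFin; rewrite -[RHS]/((\1_A y - a) * (\1_B y - b)); ring.
Qed.

End covariance_of_indicators.

Lemma ZprocSS (R : realType) (Om : Type) (I : R -> Om -> R) (X : nat -> R -> Om -> R) l u w :
  Zproc I X l.+2 u w = Zproc I X l.+1 u w - X l.+1 u w.
Proof. by rewrite /Zproc big_nat_recr//= opprD addrA. Qed.

Lemma L2dot_product_measure (R : realType) (d1 d2 : measure_display)
    (T1 : measurableType d1) (T2 : measurableType d2)
    (m1 : {sigma_finite_measure set T1 -> \bar R})
    (m2 : {sigma_finite_measure set T2 -> \bar R}) (f g : T1 * T2 -> R) :
  f \in Lfun (m1 \x m2)%E 2%:E -> g \in Lfun (m1 \x m2)%E 2%:E ->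
  ((L2dot (m1 \x m2)%E f g)%:E = \int[m1]_x \int[m2]_y (f (x, y) * g (x, y))%:E)%E.
Proof.
move=> f2 g2; rewrite -integral_mul_L2dot//.
by rewrite -(integral12_prod_meas1 (integrable_mul_Lfun2 f2 g2)).
Qed.

Section kernel.
Context {R : realType}.
Local Notation mu := (@lebesgue_measure R).
Implicit Types (f : seqR R) (k l n : nat) (u v x : R).

Definition Z_kernel : nat -> R -> R * seqR R -> R := Zproc (@Z1_integrand R) (@X_integrand R).

(* The indicators telescope: [sprod l < e^{-t}] is the disjoint union over [k < l] of the events
   [sprod k.+1 < e^{-t} <= sprod k]. *)
Lemma Z_kernelE l u x f (t := expR (- (x - u))) : (forall i, 0 <= f i <= 1) ->
  (forall k, sprod k.+1 f <> expR (- t)) ->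
  Z_kernel l.+1 u (x, f) = poisson_cdf l.+1 t - \1_(sprod_below l.+1 t) f.
Proof.
move=> f01 no_tie.
have indE k : \1_(sprod_below k t) f = (if sprod k f < expR (- t) then 1 else 0) :> R.
  by rewrite indicE; case: ifPn => below; [rewrite mem_set|rewrite memNset//; exact/negP].
elim: l => [|l ih].
  rewrite /Z_kernel /Zproc big_geq// subr0 /Z1_integrand -/t /poisson_cdf big_ord1 psi0E opprB.
  have /eqP := no_tie 0%N; rewrite indE /sprod big_ord1 le_eqVlt => /negbTE ->.
  by [].
rewrite /Z_kernel ZprocSS -/Z_kernel ih [in RHS]/poisson_cdf big_ord_recr /= -/(poisson_cdf _ _).
rewrite /X_integrand -/t psi0E /= -![\prod_(i < _) f i]/(sprod _ f) !indE.
have /eqP := no_tie l; case: (ltgtP (sprod l.+1 f)) => // below _.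
  by rewrite (le_lt_trans (ler_sprod f01 (leqnSn l.+1)) below) andbF; ring.
by rewrite andbT; case: ifP => _; ring.
Qed.

Variable P : probability (seqR R) R.
Hypothesis iidP : iid_uniform P.

Lemma Z_kernel_ae l u x (t := expR (- (x - u))) :
  \forall f \ae P, Z_kernel l.+1 u (x, f) = poisson_cdf l.+1 t - \1_(sprod_below l.+1 t) f.
Proof.
have no_tie : \forall f \ae P, forall k, sprod k.+1 f <> expR (- t).
  apply/ae_foralln => k; exists [set f | sprod k.+1 f = expR (- t)]; split.
  - exact: measurable_preimage (measurable_sprod k.+1) (measurable_set1 (expR (- t))).
  - by apply: prob_sprod_eq => //; exact: expR_gt0.
  - by move=> f /=; exact: contrapT.
move: (iid_uniform_ae_itv iidP) no_tie; apply: filterS2; first exact: (ae_filter_ringOfSetsType P).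
by move=> f; exact: Z_kernelE.
Qed.

Lemma integral_Z_kernel_mul l n u v x
    (s := expR (- (x - u))) (t := expR (- (x - v))) :
  Z_kernel l.+1 u \in Lfun (mu \x P)%E 2%:E ->
  Z_kernel (l.+1 + n) v \in Lfun (mu \x P)%E 2%:E ->
  (\int[P]_f (Z_kernel l.+1 u (x, f) * Z_kernel (l.+1 + n) v (x, f))%:E =
   (\sum_(i < l.+1) psi i s * poisson_cdf (l.+1 + n - i) (Num.max (t - s) 0)
    - poisson_cdf l.+1 s * poisson_cdf (l.+1 + n) t)%:E)%E.
Proof.
move=> /Lfun2P[mK _] /Lfun2P[mL _].
pose A := sprod_below l.+1 s; pose B := sprod_below (l.+1 + n) t.
have mA : measurable A by exact: measurable_sprod_below.
have mB : measurable B by exact: measurable_sprod_below.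
rewrite EFinB -(prob_sprod_belowI iidP) ?expR_ge0 ?leq_addr//.
rewrite -(integral_centered_indic mA mB); last 2 first.
- by rewrite (prob_sprod_below iidP) ?expR_ge0.
- by rewrite (prob_sprod_below iidP) ?expR_ge0.
apply: ae_eq_integral => //.
- apply/measurable_EFinP; apply: measurable_funM.
    exact: (measurableT_comp mK (pair1_measurable x)).
  exact: (measurableT_comp mL (pair1_measurable x)).
- by apply/measurable_EFinP; apply: measurable_funM; apply: measurable_funB.
- apply: filterS2 (Z_kernel_ae l u x) (Z_kernel_ae (l + n) v x) => f Ku Kv _.
  by rewrite Ku [X in (_ * X)%:E]Kv.
Qed.

Lemma L2dot_Z_kernel l n u v :
  Z_kernel l.+1 u \in Lfun (mu \x P)%E 2%:E ->
  Z_kernel (l.+1 + n) v \in Lfun (mu \x P)%E 2%:E ->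
  L2dot (mu \x P)%E (Z_kernel l.+1 u) (Z_kernel (l.+1 + n) v) = cross_cov l.+1 n u v.
Proof.
move=> Ku Kv; apply: EFin_inj; rewrite (L2dot_product_measure Ku Kv).
have [_ <-] := has_integral_cross_cov u v l n.
by apply: eq_integral => x _; exact: (integral_Z_kernel_mul x Ku Kv).
Qed.

End kernel.

Section covariance_bounds.
Variable R : realType.
Implicit Types (u v h : R) (l : nat).

Lemma cov_l_diag l u v : cov_l l u u = cov_l l v v.
Proof. by rewrite /cov_l !subrr. Qed.

Lemma cov_l_shift l u v h : cov_l l (u + h) (v + h) = cov_l l u v.
Proof. by rewrite /cov_l (_ : u + h - (v + h) = u - v)//; ring. Qed.

Lemma cov_l_modulus l u v : cov_l l u u - cov_l l u v <= `|u - v|.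
Proof.
rewrite /cov_l subrr normr0 oppr0 expR0; set h := `|u - v|; set q := expR (- h).
have h0 : 0 <= h by exact: normr_ge0.
have q0 : 0 < q by exact: expR_gt0.
have q1 : 0 < 1 + q by rewrite addr_gt0.
have q_le1 : q <= 1 by rewrite expR_le1 oppr_le0.
have ln_le : ln 2 - ln (1 + q) <= h.
  rewrite -ln_div ?posrE//.
  have -> : 2 / (1 + q) = 1 + (1 - q) / (1 + q) by field; rewrite gt_eqF.
  apply: (le_trans (le_ln1Dx _)).
    by rewrite (lt_le_trans (ltrN10 _))// divr_ge0 ?subr_ge0// ltW.
  have q_ge : 1 - h <= q by exact: expR_ge1Dx.
  by rewrite ler_pdivrMr//; nra.
have sum_le : \sum_(1 <= k < l)
    ((2 * k - 1)`!%:R * expR (- h * k%:R)) / (k`!%:R ^+ 2 * (1 + q) ^+ (2 * k)) <=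
  \sum_(1 <= k < l)
    ((2 * k - 1)`!%:R * expR (0 * k%:R)) / (k`!%:R ^+ 2 * (1 + 1) ^+ (2 * k)) :> R.
  have splitE (a b x y : R) k : a * x ^+ k / (b * y ^+ (2 * k)) = a / b * (x / y ^+ 2) ^+ k.
    by rewrite expr_div_n exprM invfM; ring.
  apply: ler_sum => k _; rewrite !expRM_natr -/q expR0 !splitE.
  have qq_ge0 : 0 <= q / (1 + q) ^+ 2 by rewrite divr_ge0 ?sqr_ge0// ltW.
  rewrite ler_wpM2l ?divr_ge0 ?exprn_ge0//; apply: lerXn2r.
  - by rewrite nnegrE.
  - by rewrite nnegrE divr_ge0.
  - rewrite ler_pdivrMr ?exprn_gt0// mulrAC mul1r ler_pdivlMr ?exprn_gt0//.
    by have := sqr_ge0 (1 - q); nra.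
by lra.
Qed.

End covariance_bounds.

Definition gaussian_increments (R : realType) (d : measure_display) (Om : measurableType d)
    (Prob : probability Om R) (K : R) (Z : R -> Om -> R) : Prop :=
  forall u v, exists s2 : R, [/\ 0 <= s2, s2 <= K * `|u - v| &
    gaussian_rv Prob (fun w => Z u w - Z v w) 0 s2].

Section process.
Context {R : realType} {d : measure_display} {Om : measurableType d}.
Variables (Prob : probability Om R) (P : probability (seqR R) R).
Hypothesis iidP : iid_uniform P.
Variable W : set (R * seqR R) -> Om -> R.
Local Notation mu := (lebesgue_measure \x P)%E.
Hypothesis noiseW : gaussian_white_noise Prob mu W.
Variables (I1 : R -> Om -> R) (X : nat -> R -> Om -> R).
Hypothesis I1_wiener : forall u, wiener_integral Prob mu W (Z1_integrand u) (I1 u).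
Hypothesis X_wiener : forall k u, (1 <= k)%N -> wiener_integral Prob mu W (X_integrand k u) (X k u).
Implicit Types (l n : nat) (u v : R).
Local Notation Z l := (Zproc I1 X l.+1).

Lemma Z_noise_limit l u : noise_limit Prob mu W (Z_kernel l.+1 u) (Z l u).
Proof.
elim: l => [|l ih].
  have := noise_limitB noiseW (noise_limit0 _ _ _) (wiener_noise_limit (I1_wiener u)).
  congr noise_limit; apply/funext => w; by rewrite /Z_kernel /Zproc big_geq// subr0 sub0r.
have := noise_limitB noiseW ih (wiener_noise_limit (X_wiener u (ltn0Sn l))).
by congr noise_limit; apply/funext => w; rewrite /Z_kernel ZprocSS.
Qed.

Lemma Z_L2dot l n u v : L2dot Prob (Z l u) (Z (l + n) v) = cross_cov l.+1 n u v.
Proof.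
have Ku := Z_noise_limit l u; have Kv := Z_noise_limit (l + n) v.
rewrite (noise_limit_isometry noiseW Ku Kv).
by case: Ku => Ku _ _; case: Kv => Kv _ _; exact: (L2dot_Z_kernel iidP Ku Kv).
Qed.

Lemma Z_cross_cov l n u v :
  (\int[Prob]_w (Z l u w * Z (l + n) v w)%:E = (cross_cov l.+1 n u v)%:E)%E.
Proof.
rewrite -Z_L2dot; apply: integral_mul_L2dot; apply: (noise_limit_Lfun2 noiseW).
  exact: (Z_noise_limit l u).
exact: (Z_noise_limit (l + n) v).
Qed.

Lemma cross_cov0 l u v : cross_cov l 0 u v = cov_l l u v.
Proof. by rewrite /cross_cov big_geq// addr0. Qed.

Lemma Z_cov l u v : (\int[Prob]_w (Z l u w * Z l v w)%:E = (cov_l l.+1 u v)%:E)%E.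
Proof. by have := Z_cross_cov l 0 u v; rewrite addn0 cross_cov0. Qed.

Lemma Z_gaussian l : gaussian_process Prob (Z l).
Proof.
move=> s; exists 0; eexists; split; last first.
  apply: (noise_limit_gaussian noiseW).
  exact: (noise_limit_sum noiseW s fst (fun q => Z_noise_limit l q.2)).
exact: L2dot_ge0.
Qed.

Lemma Z_centered l : centered Prob (Z l).
Proof. by move=> u; apply: (noise_limit_centered noiseW (Z_noise_limit l u)). Qed.

Lemma Z_stationary l : stationary_cov Prob (Z l).
Proof. by move=> h u v; rewrite !Z_cov cov_l_shift. Qed.

Lemma Z_gaussian_increments l : gaussian_increments Prob 2 (Z l).
Proof.
move=> u v; have Iu := Z_noise_limit l u; have Iv := Z_noise_limit l v.
have Iuv := noise_limitB noiseW Iu Iv.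
exists (L2dot mu (fun p => Z_kernel l.+1 u p - Z_kernel l.+1 v p)
  (fun p => Z_kernel l.+1 u p - Z_kernel l.+1 v p)).
split; [exact: L2dot_ge0| |exact: (noise_limit_gaussian noiseW Iuv)].
rewrite -(noise_limit_isometry noiseW Iuv Iuv).
rewrite (L2dotB_sqr (noise_limit_Lfun2 noiseW Iu) (noise_limit_Lfun2 noiseW Iv)).
have dotE a b : L2dot Prob (Z l a) (Z l b) = cov_l l.+1 a b.
  by have := Z_L2dot l 0 a b; rewrite addn0 cross_cov0.
rewrite !dotE (cov_l_diag _ v u) [leLHS](_ : _ = 2 * (cov_l l.+1 u u - cov_l l.+1 u v)).
  by rewrite ler_wpM2l// cov_l_modulus.
by ring.
Qed.

End process.

(** * Hoelder continuous version *)

Section dyadic_grid.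
Variable R : realType.
Implicit Types (x y u T : R) (n : nat) (k : int).

Definition dyadic n k : R := k%:~R / 2 ^+ n.
Definition dyadic_floor n u : R := dyadic n (Num.floor (u * 2 ^+ n)).

Lemma dyadicS n k : dyadic n.+1 (2 * k) = dyadic n k.
Proof. by rewrite /dyadic intrM exprS invfM mulrACA divff ?mul1r// pnatr_eq0. Qed.

Lemma dyadic_floor_itv n u : 0 <= u - dyadic_floor n u < 2 ^- n.
Proof.
have p0 : 0 < 2 ^+ n :> R by rewrite exprn_gt0.
have /andP[floor_le lt_floor] := floor_itv (u * 2 ^+ n).
rewrite /dyadic_floor /dyadic subr_ge0 ler_pdivrMr// floor_le/=.
by rewrite ltrBlDr -[X in X + _]mul1r -mulrDl ltr_pdivlMr// addrC -(intrD _ _ 1).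
Qed.

Lemma floor_double x :
  Num.floor (x * 2) = 2 * Num.floor x \/ Num.floor (x * 2) = 2 * Num.floor x + 1.
Proof.
have /andP[floor_le lt_floor] := floor_itv x; rewrite intrD in lt_floor.
have [lt_odd|odd_le] := ltP (x * 2) ((2 * Num.floor x + 1)%:~R).
  by left; apply: floor_def; rewrite lt_odd andbT intrM mulrC ler_wpM2r.
by right; apply: floor_def; rewrite odd_le /= !intrD intrM; move: lt_floor => /=; lra.
Qed.

Lemma floor_le_add1 x y : x <= y -> y <= x + 1 ->
  Num.floor y = Num.floor x \/ Num.floor y = Num.floor x + 1.
Proof.
move=> xy yx; have /andP[floor_le lt_floor] := floor_itv x; rewrite intrD in lt_floor.
have [lt_next|next_le] := ltP y ((Num.floor x + 1)%:~R).
  by left; apply: floor_def; rewrite lt_next andbT (le_trans floor_le).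
by right; apply: floor_def; rewrite next_le /= !intrD; move: lt_floor => /=; lra.
Qed.

Lemma norm_floor_le n u T : `|u| <= T -> T + 1 <= n%:R ->
  `|(Num.floor (u * 2 ^+ n))%:~R| <= n%:R * 2 ^+ n :> R.
Proof.
rewrite ler_norml => /andP[uT Tu] Tn.
have p1 : 1 <= 2 ^+ n :> R by rewrite exprn_ege1// ler1n.
have /andP[floor_le lt_floor] := floor_itv (u * 2 ^+ n); rewrite intrD in lt_floor.
rewrite ler_norml; apply/andP; split; last by apply: (le_trans floor_le); nra.
by move: lt_floor; rewrite /=; nra.
Qed.

Lemma dyadic_scale x n : 0 < x -> x <= 2 ^- n ->
  exists m, [/\ (n <= m)%N, x <= 2 ^- m & 2 ^- m.+1 < x].
Proof.
move=> x0 xn; have : exists m, 2 ^- m < x.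
  have [m _ small] := near_infty_natSinv_expn_lt (PosNum x0).
  by exists m; have := small m (leqnn m); rewrite div1r.
move=> /ex_minnP[[|m] mx min].
  by move: (lt_le_trans mx xn); rewrite expr0 invr1 ltNge invf_le1 ?exprn_ege1 ?exprn_gt0// ler1n.
exists m; split => //.
  rewrite leqNgt; apply/negP => mn; move: (lt_le_trans mx xn).
  by rewrite ltNge lef_pV2 ?posrE ?exprn_gt0// ler_eXn2l// ?mn// (ltr1n R 2).
by rewrite leNgt; apply/negP => /min; rewrite ltnn.
Qed.

End dyadic_grid.

Section geometric_increments.
Variable R : realType.
Implicit Types (x : nat -> R) (p b : R) (m n : nat).

Lemma linear_geometric p b : 0 < p -> p < b ->
  exists2 C : R, 0 <= C & forall n, n.+1%:R * p ^+ n <= C * b ^+ n.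
Proof.
move=> p0 pb; have bp : 0 < b - p by rewrite subr_gt0.
have b0 : 0 < b := lt_trans p0 pb.
pose C := 1 + p / (b - p); have C0 : 0 <= C by rewrite addr_ge0// divr_ge0// ltW.
have CE : C * (b - p) = b by rewrite /C; field; rewrite gt_eqF.
exists C => //; elim=> [|n ih]; first by rewrite !expr0 !mulr1 lerDl divr_ge0// ltW.
have pbn : p * p ^+ n <= p * b ^+ n by rewrite ler_pM2l// lerXn2r// ?nnegrE ltW.
have ihp : p * (n.+1%:R * p ^+ n) <= p * (C * b ^+ n) by rewrite ler_pM2l.
have bn : 0 <= b ^+ n by rewrite exprn_ge0// ltW.
rewrite -natr1 mulrDl mul1r !exprS mulrCA (le_trans (lerD ihp pbn))//.
have -> : C * (b * b ^+ n) = p * (C * b ^+ n) + C * (b - p) * b ^+ n by ring.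
by rewrite CE lerD2l ler_wpM2r// ltW.
Qed.

Variables (x : nat -> R) (K b : R) (N : nat).
Hypotheses (K0 : 0 <= K) (b0 : 0 < b) (b1 : b < 1).
Hypothesis x_increment : forall n, (N <= n)%N -> `|x n.+1 - x n| <= K * (b ^+ n - b ^+ n.+1).

Lemma geometric_increments_dist m n : (N <= n)%N -> (n <= m)%N ->
  `|x m - x n| <= K * (b ^+ n - b ^+ m).
Proof.
move=> Nn /subnK <-; elim: (m - n)%N => [|k ih]; first by rewrite add0n !subrr normr0 mulr0.
rewrite addSn (le_trans (ler_distD (x (k + n)%N) _ _))//.
have := x_increment (leq_trans Nn (leq_addl k n)).
by move=> /lerD /(_ ih) /le_trans; apply; rewrite -mulrDr addrC addrA subrK.
Qed.

Lemma geometric_increments_le m n : (N <= n)%N -> (n <= m)%N -> `|x m - x n| <= K * b ^+ n.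
Proof.
move=> Nn nm; rewrite (le_trans (geometric_increments_dist Nn nm))//.
by rewrite ler_wpM2l// gerBl exprn_ge0// ltW.
Qed.

Lemma geometric_increments_cvg : cvgn x.
Proof.
pose y m := x (m + N)%N + K * b ^+ (m + N).
have cy : cvgn y.
  apply: nonincreasing_is_cvgn.
    apply/nonincreasing_seqP => m; have := x_increment (leq_addl m N).
    by rewrite /y addSn ler_norml => /andP[_]; lra.
  exists (x N - K * b ^+ N) => _ [m _ <-].
  have := geometric_increments_le (leqnn N) (leq_addl m N).
  rewrite ler_norml => /andP[+ _].
  have : 0 <= K * b ^+ (m + N) by rewrite mulr_ge0// exprn_ge0// ltW.
  by rewrite /y; lra.
have ct : K * b ^+ (m + N) @[m --> \oo] --> (0 : R).
  rewrite (cvg_shiftn N (fun m => K * b ^+ m)); apply: cvg_geometric.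
  by rewrite ger0_norm// ltW.
apply/cvg_ex; exists (limn y - 0); rewrite -(cvg_shiftn N).
rewrite (_ : (fun n => _) = y \- (fun m => K * b ^+ (m + N))); first exact: cvgB.
by apply/funext => m; rewrite /y /= addrK.
Qed.

Lemma geometric_increments_lim n : (N <= n)%N -> `|limn x - x n| <= K * b ^+ n.
Proof.
move=> Nn; have cx := geometric_increments_cvg.
rewrite ler_distl; apply/andP; split; [apply: limr_ge|apply: limr_le] => //; exists n => // m /= nm;
  by have := geometric_increments_le Nn nm; rewrite ler_distl => /andP[].
Qed.

End geometric_increments.

Section dyadic_chaining.
Variable R : realType.
Implicit Types (u s t T : R) (g : R -> R) (n : nat) (k : int).

Definition dyadic_modulus (M b : R) n0 g : Prop := forall n k, (n0 <= n)%N ->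
  `|k%:~R| <= n%:R * 2 ^+ n :> R -> `|g (dyadic R n (k + 1)) - g (dyadic R n k)| <= M * b ^+ n.

Definition dyadic_limit g u : R := limn (fun n => g (dyadic_floor n u)).

Variables (M b : R) (n0 : nat) (g : R -> R).
Hypotheses (M0 : 0 <= M) (b0 : 0 < b) (b1 : b < 1) (g_modulus : dyadic_modulus M b n0 g).

Lemma dyadic_modulus_floor n s t T : (n0 <= n)%N -> T + 1 <= n%:R ->
  `|s| <= T -> `|t| <= T -> `|s - t| <= 2 ^- n ->
  `|g (dyadic_floor n s) - g (dyadic_floor n t)| <= M * b ^+ n.
Proof.
move=> n0n Tn; wlog st : s t / s <= t.
  move=> wl sT tT; have [st|/ltW ts] := leP s t; first exact: wl.
  by move=> st; rewrite distrC; apply: wl => //; rewrite distrC.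
move=> sT tT; rewrite distrC ger0_norm ?subr_ge0// lerBlDl => ts.
have p0 : 0 < 2 ^+ n :> R by rewrite exprn_gt0.
have st2 : s * 2 ^+ n <= t * 2 ^+ n by rewrite ler_pM2r.
have ts2 : t * 2 ^+ n <= s * 2 ^+ n + 1.
  by rewrite -ler_pdivlMr// mulrDl mulfK ?gt_eqF// mul1r.
rewrite /dyadic_floor distrC; have [->|->] := floor_le_add1 st2 ts2.
- by rewrite subrr normr0 mulr_ge0// exprn_ge0// ltW.
- by apply: g_modulus => //; exact: norm_floor_le sT Tn.
Qed.

Lemma dyadic_modulus_floorS n u T : (n0 <= n)%N -> T + 1 <= n%:R -> `|u| <= T ->
  `|g (dyadic_floor n.+1 u) - g (dyadic_floor n u)| <= M * b ^+ n.+1.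
Proof.
move=> n0n Tn uT; rewrite /dyadic_floor -(dyadicS R n) exprSr mulrA.
have [->|->] := floor_double (u * 2 ^+ n).
  by rewrite subrr normr0 mulr_ge0// exprn_ge0// ltW.
apply: g_modulus; first exact: leqW.
rewrite intrM normrM exprS mulrCA (@ger0_norm _ 2%:~R)// ler_pM2l//.
apply: (le_trans (norm_floor_le uT Tn)); rewrite ler_pM2r ?exprn_gt0//.
by rewrite ler_nat.
Qed.

Let K : R := M * b / (1 - b).

Let K0 : 0 <= K.
Proof. by rewrite divr_ge0 ?mulr_ge0// ?subr_ge0 ltW. Qed.

Lemma dyadic_floor_increment N u T : (n0 <= N)%N -> T + 1 <= N%:R -> `|u| <= T ->
  forall n, (N <= n)%N ->
  `|g (dyadic_floor n.+1 u) - g (dyadic_floor n u)| <= K * (b ^+ n - b ^+ n.+1).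
Proof.
move=> n0N TN uT n Nn; rewrite [leRHS](_ : _ = M * b ^+ n.+1); last first.
  by rewrite /K exprS; field; rewrite subr_eq0 gt_eqF.
apply: (dyadic_modulus_floorS _ _ uT); first exact: leq_trans Nn.
by rewrite (le_trans TN)// ler_nat.
Qed.

Lemma dyadic_modulus_cvg u : cvgn (fun n => g (dyadic_floor n u)).
Proof.
have [N _ uN] : \forall n \near \oo, `|u| + 1 <= n%:R :> R by exact: nbhs_infty_ger.
apply: (@geometric_increments_cvg _ _ K b (maxn n0 N)) => //.
apply: (dyadic_floor_increment _ _ (lexx _)); first exact: leq_maxl.
by apply: uN; exact: leq_maxr.
Qed.

Lemma dyadic_limit_modulus n s t T : (n0 <= n)%N -> T + 1 <= n%:R ->
  `|s| <= T -> `|t| <= T -> `|s - t| <= 2 ^- n ->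
  `|dyadic_limit g s - dyadic_limit g t| <= (M + 2 * K) * b ^+ n.
Proof.
move=> n0n Tn sT tT st.
have lim u : `|u| <= T -> `|dyadic_limit g u - g (dyadic_floor n u)| <= K * b ^+ n.
  by move=> uT; apply: (geometric_increments_lim K0 b0 b1 (dyadic_floor_increment n0n Tn uT)).
have := lim s sT; have := lim t tT; have := dyadic_modulus_floor n0n Tn sT tT st.
rewrite !ler_distl => /andP[? ?] /andP[? ?] /andP[? ?].
by apply/andP; split; lra.
Qed.

End dyadic_chaining.

Section hoelder.
Variable R : realType.
Implicit Types (a C : R) (f g : R -> R).

Lemma near_locally_hoelder f a : 0 <= a ->
  (forall T, 0 < T -> exists2 C : R, 0 <= C & exists N, forall s t,
    `|s| <= T -> `|t| <= T -> `|s - t| <= 2 ^- N -> `|f s - f t| <= C * `|s - t| `^ a) ->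
  locally_hoelder f a.
Proof.
move=> a0 near_hoelder T T0; have [C C0 [N near]] := near_hoelder T T0.
have [m _ /(_ m (leqnn m)) Tm] : \forall m \near \oo, 2 * T * 2 ^+ N <= m%:R.
  exact: nbhs_infty_ger.
have m0 : 0 < m%:R :> R by rewrite (lt_le_trans _ Tm)// !mulr_gt0// exprn_gt0.
exists (m%:R * C) => s t sT tT; pose q (j : nat) := s + (t - s) * (j%:R / m%:R).
have qT j : (j <= m)%N -> `|q j| <= T.
  move=> jm; move: sT tT; rewrite !ler_norml => /andP[? ?] /andP[? ?].
  have j0 : 0 <= j%:R / m%:R :> R by rewrite divr_ge0.
  have j1 : j%:R / m%:R <= 1 :> R by rewrite ler_pdivrMr// mul1r ler_nat.
  by rewrite /q; apply/andP; split; nra.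
have q_step j : `|q j - q j.+1| = `|s - t| / m%:R.
  rewrite /q (_ : _ - _ = (s - t) / m%:R); last by rewrite -natr1; field; rewrite gt_eqF.
  by rewrite normrM normfV (@ger0_norm _ m%:R).
have step_le j : (j < m)%N -> `|f (q j) - f (q j.+1)| <= C * `|s - t| `^ a.
  move=> jm; apply: (le_trans (near _ _ (qT _ (ltnW jm)) (qT _ jm) _)); rewrite q_step.
    rewrite ler_pdivrMr// mulrC ler_pdivlMr ?exprn_gt0// (le_trans _ Tm)//.
    by rewrite ler_pM2r ?exprn_gt0// (le_trans (ler_normB _ _))//; lra.
  rewrite ler_wpM2l// ge0_ler_powR ?nnegrE ?divr_ge0//.
  by rewrite ler_pdivrMr// ler_peMr// ler1n -(ltr0n R).
have chain j : (j <= m)%N -> `|f (q 0%N) - f (q j)| <= j%:R * (C * `|s - t| `^ a).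
  elim: j => [|j ih] jm; first by rewrite subrr normr0 mul0r.
  apply: (le_trans (ler_distD (f (q j)) _ _)).
  by rewrite -natr1 mulrDl mul1r lerD ?step_le// ih// ltnW.
have := chain m (leqnn m).
by rewrite /q mul0r mulr0 addr0 divff ?gt_eqF// mulr1 subrKC mulrA.
Qed.

Lemma dyadic_limit_hoelder M n0 g a : 0 <= M -> 0 < a ->
  dyadic_modulus M (2^-1 `^ a) n0 g -> locally_hoelder (dyadic_limit g) a.
Proof.
move=> M0 a0 g_modulus; set b := 2^-1 `^ a in g_modulus.
have b0 : 0 < b by rewrite powR_gt0// invr_gt0.
have b1 : b < 1.
  rewrite /b /powR invr_eq0 pnatr_eq0/= expR_lt1 pmulr_rlt0// ln_lt0//.
  by rewrite invr_gt0 ltr0n invf_lt1// ltr1n.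
have bE m : b ^+ m = (2 ^- m) `^ a.
  have half_ge0 : 0 <= 2^-1 :> R by rewrite invr_ge0.
  by rewrite -exprVn -(powR_mulrn m (ltW b0)) -(powR_mulrn m half_ge0) powRAC.
apply: near_locally_hoelder (ltW a0) _ => T T0.
pose K := M + 2 * (M * b / (1 - b)).
have K0 : 0 <= K by rewrite addr_ge0// mulr_ge0// divr_ge0 ?mulr_ge0// ?subr_ge0 ltW.
have [N _ TN] : \forall n \near \oo, T + 1 <= n%:R :> R by exact: nbhs_infty_ger.
exists (K / b); first by rewrite divr_ge0// ltW.
exists (maxn n0 N) => s t sT tT; have [->|st] := eqVneq s t.
  by rewrite !subrr normr0 mulr_ge0 ?powR_ge0// divr_ge0// ltW.
have st0 : 0 < `|s - t| by rewrite normr_gt0 subr_eq0.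
move=> /(dyadic_scale st0)[m []]; rewrite geq_max => /andP[n0m Nm] stm mst.
apply: (le_trans (dyadic_limit_modulus M0 b0 b1 g_modulus n0m (TN m Nm) sT tT stm)).
rewrite -/K -mulrA ler_wpM2l// mulrC ler_pdivlMr// -exprSr bE.
by rewrite ge0_ler_powR ?nnegrE ?invr_ge0 ?exprn_ge0// ltW.
Qed.

End hoelder.

Section borel_cantelli.
Context {R : realType} {d : measure_display} {T : measurableType d}.
Variable mu : {measure set T -> \bar R}.
Implicit Types (F : nat -> set T).

Lemma measurable_lim_sup_set F : (forall n, measurable (F n)) -> measurable (lim_sup_set F).
Proof. by move=> mF; apply: bigcap_measurable => // n _; apply: bigcup_measurable => k _. Qed.

Lemma lim_sup_setN F w : ~ lim_sup_set F w -> exists n0, forall n, (n0 <= n)%N -> ~ F n w.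
Proof.
by move=> /existsNP[n0 /not_implyP[_ noF]]; exists n0 => n n0n Fn; apply: noF; exists n.
Qed.

Lemma measure_lim_sup_set0 F : (forall n, measurable (F n)) ->
  (forall n, mu (F n) <= (1 / (2 ^ n.+1)%:R)%:E)%E -> mu (lim_sup_set F) = 0%E.
Proof.
move=> mF F_le; apply: lim_sup_set_cvg0 => //.
apply: (@le_lt_trans _ _ (\sum_(0 <= n <oo) (1 / (2 ^ n.+1)%:R)%:E)%E).
  by apply: lee_nneseries => // n _; exact: F_le.
exact: le_lt_trans (epsilon_trick0 xpredT ler01) (ltry _).
Qed.

End borel_cantelli.

Section continuous_version.
Context {R : realType} {d : measure_display} {Om : measurableType d}.
Variables (Prob : probability Om R) (K : R) (Z : R -> Om -> R).
Hypotheses (K_gt0 : 0 < K) (mZ : forall u, measurable_fun setT (Z u)).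
Hypothesis Z_increments : gaussian_increments Prob K Z.
Implicit Types (u v : R) (n : nat) (k : int) (w : Om).

Let r : R := Num.sqrt 2^-1.

Let r_gt0 : 0 < r.
Proof. by rewrite sqrtr_gt0 invr_gt0. Qed.

Let r_sqr : r ^+ 2 = 2^-1.
Proof. by rewrite sqr_sqrtr// invr_ge0. Qed.

(* Up to constants, the standard deviation of an increment over [2^-n], times [n.+1] so that the
   Gaussian tails are summable against the number of dyadic intervals. *)
Definition oscillation n : R := 4 * Num.sqrt K * (n.+1%:R * r ^+ n).

Lemma oscillation_gt0 n : 0 < oscillation n.
Proof. by rewrite /oscillation !mulr_gt0// ?sqrtr_gt0// exprn_gt0. Qed.

Lemma oscillation_le b : r < b ->
  exists2 M : R, 0 <= M & forall n, oscillation n <= M * b ^+ n.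
Proof.
move=> rb; have [C C0 geo] := linear_geometric r_gt0 rb.
exists (4 * Num.sqrt K * C) => [|n]; first by rewrite !mulr_ge0// sqrtr_ge0.
by rewrite /oscillation -[leRHS]mulrA ler_wpM2l// mulr_ge0// sqrtr_ge0.
Qed.

Lemma oscillation_cvg : oscillation n @[n --> \oo] --> (0 : R).
Proof.
have [|M M0 geo] := @oscillation_le (4 / 5); first by move: r_sqr r_gt0; nra.
apply: (@squeeze_cvgr _ _ _ _ (cst 0) (geometric M (4 / 5))).
- by near=> n; rewrite ltW ?oscillation_gt0//=.
- exact: cvg_cst.
- by apply: cvg_geometric; rewrite ger0_norm; lra.
Unshelve. all: by end_near. Qed.

Lemma prob_increment_le n u v : `|u - v| <= 2 ^- n ->
  (Prob [set w | (oscillation n <= `|Z u w - Z v w|)%R] <= (2 * 2^-1 ^+ (4 * n.+1))%:E)%E.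
Proof.
move=> uv; have [s2 [s2_ge0 s2_le gauss]] := Z_increments u v.
have t2_gt0 : 0 < K * 2 ^- n by rewrite mulr_gt0// invr_gt0 exprn_gt0.
have s2_le_t2 : s2 <= K * 2 ^- n by apply: (le_trans s2_le); rewrite ler_pM2l.
apply: (le_trans (gaussian_rv_tail s2_ge0 s2_le_t2 t2_gt0 (oscillation_gt0 n) gauss)).
rewrite lee_fin; apply: ler_pM; rewrite ?sqrtr_ge0 ?expR_ge0//.
  by have := sqr_sqrtr (ler0n R 2); have := sqrtr_ge0 (2 : R); nra.
have -> : oscillation n ^+ 2 / (4 * (K * 2 ^- n)) = 4 * n.+1%:R ^+ 2.
  rewrite /oscillation !exprMn -exprM mulnC exprM !sqr_sqrtr ?invr_ge0 ?(ltW K_gt0)// exprVn.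
  by field; rewrite (gt_eqF K_gt0) expf_neq0.
have half_exp : expR (- 1) <= 2^-1 :> R.
  by rewrite expRN lef_pV2 ?posrE ?expR_gt0//; exact: expR_ge1Dx.
apply: (@le_trans _ _ (expR (- 1) ^+ (4 * n.+1))); last first.
  by rewrite lerXn2r// nnegrE ?expR_ge0// invr_ge0.
rewrite -expRM_natr ler_expR mulN1r lerN2 natrM.
have n1 : 1 <= n.+1%:R :> R by rewrite ler1n.
by nra.
Qed.

Lemma measurable_large_increment u v c : measurable [set w | (c <= `|Z u w - Z v w|)%R].
Proof. by apply: measurable_norm_ge; exact: measurable_funB. Qed.

Definition large_increment n k : set Om :=
  [set w | (oscillation n <= `|Z (dyadic R n (k + 1)) w - Z (dyadic R n k) w|)%R].

Definition some_large_increment n : set Om :=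
  \big[setU/set0]_(i < (2 * (n * 2 ^ n)).+1) large_increment n (i%:Z - (n * 2 ^ n)%:Z).

Lemma measurable_some_large_increment n : measurable (some_large_increment n).
Proof. by apply: bigsetU_measurable => i _; exact: measurable_large_increment. Qed.

Lemma prob_some_large_increment n :
  (Prob (some_large_increment n) <= (1 / (2 ^ n.+1)%:R)%:E)%E.
Proof.
pose F (i : nat) := large_increment n (i%:Z - (n * 2 ^ n)%:Z).
have mF i : measurable (F i) by exact: measurable_large_increment.
apply: (le_trans (@Boole_inequality _ _ _ Prob F _ (fun i _ => mF i))).
apply: (@le_trans _ _ (\sum_(i < (2 * (n * 2 ^ n)).+1) (2 * 2^-1 ^+ (4 * n.+1))%:E)%E).
  apply: lee_sum => i _; apply: prob_increment_le.
  by rewrite /dyadic intrD -mulrBl addrAC subrr add0r mul1r ger0_norm// invr_ge0 exprn_ge0.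
rewrite sumEFin lee_fin sumr_const card_ord -[X in X <= _]mulr_natl div1r.
have card_le : (2 * (n * 2 ^ n)).+1%:R * 2 <= 2 ^+ (3 * n.+1) :> R.
  rewrite -natrM -natrX ler_nat.
  have n_lt : (n.+1 <= 2 ^ n)%N by exact: ltn_expl.
  have -> : (2 ^ (3 * n.+1) = 2 * (2 ^ n * (2 * (2 * (2 ^ n * 2 ^ n)))))%N.
    by rewrite (_ : 3 * n.+1 = (n + n + n).+3)%N; [rewrite !expnS !expnD; lia|lia].
  by nia.
rewrite mulrA; apply: (@le_trans _ _ (2 ^+ (3 * n.+1) * 2^-1 ^+ (4 * n.+1))).
  by rewrite ler_wpM2r// exprn_ge0// invr_ge0.
rewrite (_ : 4 * n.+1 = 3 * n.+1 + n.+1)%N; last by lia.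
by rewrite exprD mulrA -exprMn divff ?pnatr_eq0// expr1n mul1r exprVn natrX.
Qed.

Lemma dyadic_modulus_path w b : ~ lim_sup_set some_large_increment w -> r < b ->
  exists M n0, 0 <= M /\ dyadic_modulus M b n0 (Z^~ w).
Proof.
move=> /lim_sup_setN[n0 small] /oscillation_le[M M0 osc_le].
exists M, n0; split=> // n k /small {}small kn; apply: le_trans (osc_le n).
rewrite leNgt; apply/negP => /ltW large; apply: small.
have : `|k| <= (n * 2 ^ n)%:Z.
  by move: kn; rewrite -intr_norm -natrX -natrM -(ler_int R) /= => /le_trans; apply.
rewrite ler_norml => /andP[k_ge k_le].
have kE : (absz (k + (n * 2 ^ n)%:Z))%:Z = k + (n * 2 ^ n)%:Z.
  by rewrite gez0_abs// -lerBlDr sub0r.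
rewrite /some_large_increment.
rewrite -(bigcup_mkord _ (fun i : nat => large_increment n (i%:Z - (n * 2 ^ n)%:Z))).
exists (absz (k + (n * 2 ^ n)%:Z)); last by rewrite kE addrK.
by rewrite /= ltnS -lez_nat kE; move: k_le; lia.
Qed.

Lemma dyadic_floor_cvg_ae u :
  \forall w \ae Prob, Z (dyadic_floor n u) w @[n --> \oo] --> Z u w.
Proof.
pose F n := [set w | (oscillation n <= `|Z (dyadic_floor n u) w - Z u w|)%R].
have mF n : measurable (F n) by exact: measurable_large_increment.
exists (lim_sup_set F); split; first exact: measurable_lim_sup_set.
  apply: measure_lim_sup_set0 => // n; apply: (le_trans (@prob_increment_le n _ _ _)).
    by have /andP[? /ltW ?] := dyadic_floor_itv n u; rewrite distrC ger0_norm.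
  rewrite lee_fin div1r natrX -exprVn (_ : 4 * n.+1 = n.+1 + (3 * n).+2.+1)%N; last by lia.
  rewrite exprD [X in _ * (_ * X)]exprS mulrCA mulVKf ?pnatr_eq0//.
  by rewrite ler_piMr ?exprn_ge0 ?invr_ge0// exprn_ile1 ?invr_ge0// invf_le1// ler1n.
move=> w; apply: contra_notP => /lim_sup_setN[n0 small].
apply/cvgrPdist_le => e e0.
have [N _ osc_lt] : \forall n \near \oo, oscillation n < e.
  by apply: (cvgr_lt _ oscillation_cvg).
exists (maxn n0 N) => // n /=; rewrite geq_max => /andP[/small {}small /osc_lt/ltW].
by apply: le_trans; rewrite distrC leNgt; apply/negP => /ltW.
Qed.

Let irregular : set Om := lim_sup_set some_large_increment.

Let measurable_irregular : measurable irregular.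
Proof. by apply: measurable_lim_sup_set; exact: measurable_some_large_increment. Qed.

Definition dyadic_version u w : R := \1_(~` irregular) w * dyadic_limit (Z^~ w) u.

Let versionE u w : ~ irregular w -> dyadic_version u w = dyadic_limit (Z^~ w) u.
Proof. by move=> irr_w; rewrite /dyadic_version indicE mem_set ?mul1r. Qed.

Let version0 u w : irregular w -> dyadic_version u w = 0.
Proof. by move=> irr_w; rewrite /dyadic_version indicE memNset ?mul0r// => /(_ irr_w). Qed.

Lemma measurable_dyadic_version u : measurable_fun setT (dyadic_version u).
Proof.
apply: (@measurable_fun_cvg _ _ _ _ (fun n w => \1_(~` irregular) w * Z (dyadic_floor n u) w)).
  by move=> n; apply: measurable_funM => //; apply: measurable_indic; exact: measurableC.
move=> w _; have [irr_w|irr_w] := pselect (irregular w).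
  rewrite version0// (_ : (fun n => _) = cst 0); first exact: cvg_cst.
  by apply/funext => n; rewrite indicE memNset ?mul0r// => /(_ irr_w).
apply: cvgM; first exact: cvg_cst.
have r1 : r < 1 by move: r_sqr r_gt0; nra.
have [rb b1] := midf_lt r1.
have [M [n0 [M0 path_modulus]]] := dyadic_modulus_path irr_w rb.
exact: (dyadic_modulus_cvg M0 (lt_trans r_gt0 rb) b1 path_modulus).
Qed.

Lemma prob_dyadic_version_neq u : Prob [set w | dyadic_version u w != Z u w] = 0%E.
Proof.
have [N [mN N0 cvgN]] := dyadic_floor_cvg_ae u.
have negligible_irrN : Prob.-negligible (irregular `|` N).
  apply: negligibleU; apply/negligibleP => //; apply: measure_lim_sup_set0.
    exact: measurable_some_large_increment.
  exact: prob_some_large_increment.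
apply: measure_negligible; first exact: measurable_neq (measurable_dyadic_version u) (mZ u).
apply: negligibleS negligible_irrN => w /= neq.
have [irr_w|irr_w] := pselect (irregular w); [by left|right].
apply: cvgN => lim; move/eqP: neq; apply; rewrite versionE//.
exact: (cvg_lim _ lim).
Qed.

Lemma dyadic_version_hoelder w a : 0 < a < 2^-1 ->
  locally_hoelder (fun u => dyadic_version u w) a.
Proof.
move=> /andP[a0 a12]; have [irr_w|irr_w] := pselect (irregular w).
  by move=> T _; exists 0 => s t _ _; rewrite !version0// subrr normr0 mul0r.
have rb : r < 2^-1 `^ a.
  rewrite /r -powR12_sqrt ?invr_ge0// /powR invr_eq0 pnatr_eq0 /=.
  by rewrite ltr_expR ltr_nM2r// ln_lt0// invr_gt0 ltr0n invf_lt1// ltr1n.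
under eq_fun do rewrite versionE//.
have [M [n0 [M0 path_modulus]]] := dyadic_modulus_path irr_w rb.
exact: dyadic_limit_hoelder M0 a0 path_modulus.
Qed.

End continuous_version.

Theorem theorem1p8 (R : realType) (d : measure_display) (Om : measurableType d)
  (Prob : probability Om R) (P : probability (seqR R) R)
  (HP : iid_uniform P)
  (W : set (R * seqR R) -> Om -> R)
  (HW : gaussian_white_noise Prob (lebesgue_measure \x P)%E W)
  (I1 : R -> Om -> R) (X : nat -> R -> Om -> R)
  (HI1 : forall u : R,
     wiener_integral Prob (lebesgue_measure \x P)%E W (Z1_integrand u) (I1 u))
  (HX : forall (k : nat) (u : R), (1 <= k)%N ->
     wiener_integral Prob (lebesgue_measure \x P)%E W (X_integrand k u) (X k u)) :
  forall l : nat, (1 <= l)%N ->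
  [/\ gaussian_process Prob (Zproc I1 X l)
      /\ centered Prob (Zproc I1 X l)
      /\ stationary_cov Prob (Zproc I1 X l),
      (forall u v : R,
         (\int[Prob]_w (Zproc I1 X l u w * Zproc I1 X l v w)%:E)%E = (cov_l l u v)%:E),
      (forall (n : nat) (u v : R),
         (\int[Prob]_w (Zproc I1 X l u w * Zproc I1 X (l + n) v w)%:E)%E
           = (cross_cov l n u v)%:E) &
      exists Y : R -> Om -> R,
        (forall u : R, measurable_fun setT (Y u) /\
           Prob [set w | Y u w != Zproc I1 X l u w] = 0%E) /\
        (forall (w : Om) (a : R), 0 < a < 2^-1 ->
           locally_hoelder (fun u => Y u w) a)].
Proof.
case=> [//|l] _; split.
- split; first exact: (Z_gaussian HW HI1 HX).
  split; first exact: (Z_centered HW HI1 HX).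
  exact: (Z_stationary HP HW HI1 HX).
- exact: (Z_cov HP HW HI1 HX).
- exact: (Z_cross_cov HP HW HI1 HX).
- have mZ u : measurable_fun setT (Zproc I1 X l.+1 u) by case: (Z_noise_limit HW HI1 HX l u).
  have incr := Z_gaussian_increments HP HW HI1 HX l.
  exists (dyadic_version 2 (Zproc I1 X l.+1)); split=> [u|w a].
    split; first exact: (measurable_dyadic_version (ltr0Sn R 1) mZ u).
    exact: (prob_dyadic_version_neq (ltr0Sn R 1) mZ incr u).
  exact: dyadic_version_hoelder.
Qed.
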